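(* Let $D\subset\mathbb{R}^2$ be a bounded simply connected domain with $C^1$ boundary and barycenter at the origin, which is either convex or, more generally, belongs to the class $\Sigma_{\arccos\frac{1}{\sqrt5}}$ (defined in the context). Assume that $\chi_D$ is a V-state with angular velocity $\Omega<0$, i.e. there is a constant $\mu\in\mathbb{R}$ with $$\psi(x)-\tfrac12\Omega|x|^2=\mu\quad\text{for all }x\in\partial D,\qquad \psi(x)=\frac1{2\pi}\int_D\log|x-y|\,dy .$$ Then $D$ is a disc.
   Context: A V-state (rotating patch) for the 2D incompressible Euler equations is a domain $D$ such that the vortex patch $\omega_0=\chi_D$ evolves as $\omega(t)=\chi_{D_t}$ with $D_t$ the rotation of $D$ about its barycenter (taken to be $0$) by angle $\Omega t$; for a $C^1$ boundary this is equivalent to the boundary equation displayed in the claim, where $\psi$ is the stream function of $\chi_D$. For $x_0\in\partial D$ let $\vec\nu(x_0)$ be the outward unit normal. For $\alpha\in[0,\pi/2]$ set $\mathrm{Sec}_{x_0,\alpha}=\{x\in\mathbb{R}^2\setminus\{x_0\}:\ \cos\alpha\le \frac{x-x_0}{|x-x_0|}\cdot\vec\nu(x_0)\}$, $D^+_{x_0}=\{x\in D:(x-x_0)\cdot\vec\nu(x_0)\ge0\}$, and $D^-_{x_0}=\{x-2[(x-x_0)\cdot\vec\nu(x_0)]\vec\nu(x_0): x\in D^+_{x_0}\}$ (reflection of $D^+_{x_0}$ across the tangent line at $x_0$). A $C^1$ bounded simply connected domain $D$ with barycenter $0$ belongs to the class $\Sigma_\alpha$ if for every $x_0\in\partial D$: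 (1) $x_0\cdot\vec\nu(x_0)\ge0$; (2) $\mathrm{Sec}_{x_0,\alpha}\cap D=\varnothing$; (3) $D^-_{x_0}\subset D$. *)

(* Defs.v *)
From HB Require Import structures.
From mathcomp Require Import all_boot all_order all_algebra.
From mathcomp Require Import all_classical all_reals all_analysis.
Set Implicit Arguments. Unset Strict Implicit. Unset Printing Implicit Defensive.
Import Order.TTheory GRing.Theory Num.Theory.
Import numFieldNormedType.Exports.
Local Open Scope classical_set_scope.
Local Open Scope ring_scope.

Section Plane.
Variable R : realType.
Notation P := (R * R)%type.

(* Euclidean structure on the plane (note: the library norm on R*R is the max norm) *)
Definition padd (x y : P) : P := (x.1 + y.1, x.2 + y.2).
Definition psub (x y : P) : P := (x.1 - y.1, x.2 - y.2).
Definition pscale (a : R) (x : P) : P := (a * x.1, a * x.2).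
Definition dot (x y : P) : R := x.1 * y.1 + x.2 * y.2.
Definition enorm (x : P) : R := Num.sqrt (dot x x).
Definition perp (v : P) : P := (- v.2, v.1).

Definition pbounded (D : set P) := exists M : R, forall x, D x -> enorm x <= M.

Definition boundary (D : set P) : set P := closure D `\` D.

Definition simply_connected (D : set P) :=
  connected D /\
  forall g : R -> P,
    {within `[0, 1], continuous g} -> g 0 = g 1 ->
    (forall t, t \in `[0, 1] -> D (g t)) ->
    exists H : P -> P,
      [/\ {within `[0, 1] `*` `[0, 1], continuous H},
          forall t, t \in `[0, 1] -> H (0, t) = g t,
          forall t, t \in `[0, 1] -> H (1, t) = H (1, 0),
          forall s, s \in `[0, 1] -> H (s, 0) = H (s, 1) &
          forall s t, s \in `[0, 1] -> t \in `[0, 1] -> D (H (s, t))].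

Definition bsc_domain (D : set P) :=
  open D /\ D !=set0 /\ pbounded D /\ simply_connected D.

(* nu is the outward unit normal at x0 : near x0, D is the region strictly
   below the graph of a C^1 function f (with f 0 = 0, f' 0 = 0), in the
   orthonormal frame (perp nu, nu) centered at x0 *)
Definition is_outward_normal (D : set P) (x0 nu : P) :=
  enorm nu = 1 /\
  exists r : R, 0 < r /\
  exists f : R -> R,
    [/\ f 0 = 0, (forall s, derivable f s 1), continuous (derive1 f), derive1 f 0 = 0 &
        forall s t : R,
          enorm (padd (pscale s (perp nu)) (pscale t nu)) < r ->
          (D (padd x0 (padd (pscale s (perp nu)) (pscale t nu))) <-> t < f s)].

Definition C1_boundary (D : set P) :=
  forall x0, boundary D x0 -> exists nu, is_outward_normal D x0 nu.

Definition leb2 := ((@lebesgue_measure R) \x (@lebesgue_measure R))%E.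

Definition barycenter_zero (D : set P) :=
  Rintegral leb2 D (fun y => y.1) = 0 /\ Rintegral leb2 D (fun y => y.2) = 0.

Definition pconvex (D : set P) :=
  forall x y t, D x -> D y -> 0 <= t <= 1 ->
    D (padd (pscale t x) (pscale (1 - t) y)).

Definition Sigma (alpha : R) (D : set P) :=
  bsc_domain D /\ C1_boundary D /\ barycenter_zero D /\
  forall x0 nu, boundary D x0 -> is_outward_normal D x0 nu ->
    [/\ 0 <= dot x0 nu,
        (forall x, x <> x0 ->
           cos alpha <= dot (pscale (enorm (psub x x0))^-1 (psub x x0)) nu ->
           ~ D x) &
        (forall x, D x -> 0 <= dot (psub x x0) nu ->
           D (psub x (pscale (2 * dot (psub x x0) nu) nu)))].

Definition stream (D : set P) (x : P) : R :=
  (2 * pi)^-1 * Rintegral leb2 D (fun y => ln (enorm (psub x y))).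

Definition Vstate (D : set P) (Omega : R) :=
  exists mu : R, forall x, boundary D x ->
    stream D x - 2^-1 * Omega * (enorm x) ^+ 2 = mu.

Definition is_disc (D : set P) :=
  exists (c : P) (r : R), 0 < r /\ D = [set x | enorm (psub x c) < r].

End Plane.

(* Main.v *)
Require Import Defs.
From HB Require Import structures.
From mathcomp Require Import all_boot all_order all_algebra.
From mathcomp Require Import all_classical all_reals all_analysis.
From mathcomp Require Import measurable_realfun ring lra.
Set Implicit Arguments. Unset Strict Implicit. Unset Printing Implicit Defensive.
Import Order.TTheory GRing.Theory Num.Theory.
Import numFieldNormedType.Exports.
Local Open Scope classical_set_scope.
Local Open Scope ring_scope.

(* Moving planes, with the boundary equation used in integral form.  Write
   refl e l for the reflection across {y.e = l}, and suppose that the cap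
   D /\ {y.e > l} is reflected into D.  For z.e > l with z and its mirror image
   outside D, the function y |-> ln|z-y| - ln|refl z - y| is odd under the
   reflection and on {y.e < l} it is at least c (z.e - l)(l - y.e), so its
   integral over D is at least c (z.e - l) times the integral of l - y.e over
   D, which is l |D| because the barycenter is 0.  Hence
     stream z - stream (refl z) >= c (z.e - l) l |D|.
   For l > 0 and Omega < 0 this excludes an interior touching of the reflected
   cap with the boundary; it also excludes a boundary point on the line with e
   tangent, because stream is Lipschitz and near such a point the boundary is
   symmetric up to o(z.e - l).  So the planes can be moved down to l = 0 in
   every direction, and D is radial.  Convexity, or the condition
   x.nu >= 0 on the boundary, then rules out holes. *)

(** * Invariance of plane Lebesgue measure under reflections *)

Section PlaneMeasure.
Variable R : realType.
Notation P := (R * R)%type.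
Notation PM := (measurableTypeR R * measurableTypeR R)%type.

Lemma nbhs_boxP (x : P) (A : set P) :
  nbhs x A <-> exists2 e : R, 0 < e &
    forall y : P, `|y.1 - x.1| < e -> `|y.2 - x.2| < e -> A y.
Proof.
split.
- move=> /nbhs_ballP[e /= e0 eA]; exists e => // y y1 y2; apply: eA.
  by split; rewrite /ball /= distrC.
- move=> [e e0 eA]; apply/nbhs_ballP; exists e => // y [/= y1 y2].
  by apply: eA; rewrite distrC.
Qed.

(** Measurability refers to the product sigma-algebra, so [D] is written as a countable union of
    rectangles: the squares with rational centre and half-side that lie in [D]. *)
Lemma open_measurable_plane (D : set P) : open D -> measurable (D : set PM).
Proof.
move=> oD.
pose F (p : rat * rat * rat) : set P :=
  let B := `]ratr p.1.1 - ratr p.2, ratr p.1.1 + ratr p.2[%classic `*`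
           `]ratr p.1.2 - ratr p.2, ratr p.1.2 + ratr p.2[%classic in
  if pselect (B `<=` D) then B else set0.
rewrite (_ : D = \bigcup_p F p); last first.
  apply/seteqP; split => [x Dx|x [p _]]; last first.
    by rewrite /F; case: pselect => //= s; exact: s.
  move: (oD); rewrite openE => /(_ _ Dx) /nbhs_boxP [e e0 eD].
  (* The centre is within e/4 of [x] coordinatewise and the half-side is between e/4 and 3e/4, so
     the square contains [x] and stays within e of it. *)
  have h a : exists q : rat, a - e / 4 < (ratr q : R) < a + e / 4.
    have /dense_rat : (`]a - e / 4, a + e / 4[ : set R) !=set0.
      exists a; rewrite /= in_itv /=; apply/andP; split; lra.
    move=> /(_ (itv_open _ _)) [y [/= + [q _ qy]]].
    by rewrite in_itv /= -qy; exists q.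
  have [q1 /andP[q11 q12]] := h x.1; have [q2 /andP[q21 q22]] := h x.2.
  have [q /andP[qe1 qe2]] := h (e/2).
  exists ((q1, q2), q) => //; rewrite /F /=.
  case: pselect => /=; last first.
    case=> y [] /=; rewrite !in_itv /= => [] /andP[y1 y2] /andP[y3 y4].
    by apply: eD; rewrite ltr_norml; apply/andP; split; lra.
  by move=> _; split => /=; rewrite in_itv /=; apply/andP; split; lra.
apply: countable_bigcupT_measurable.
  exact: countableP.
move=> p; rewrite /F; case: pselect => [?|?] /=; last exact: measurable0.
by apply: measurableX; exact: measurable_itv.
Qed.

Lemma lebesgue_measure_shift (a : R) (A : set R) : measurable A ->
  lebesgue_measure ((fun x => x + a) @^-1` A) = lebesgue_measure A.
Proof.
move=> mA.
have mf : measurable_fun setT ((fun x => x + a) : measurableTypeR R -> measurableTypeR R).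
  by apply: measurable_funD => //; exact: measurable_cst.
apply/esym; rewrite -[RHS]/(pushforward lebesgue_measure ((fun x => x + a) : measurableTypeR R -> measurableTypeR R) A).
apply: lebesgue_measure_unique => //= _ [[b c]] _ <-.
rewrite /pushforward.
rewrite (_ : _ @^-1` _ = `]b - a, c - a]%classic); last first.
  by apply/seteqP; split => x /=; rewrite !in_itv /= lerBrDr ltrBlDr.
rewrite !lebesgue_measure_itv/= !lte_fin ltrD2r.
by case: ifP => // _; rewrite -!EFinB; congr EFin; ring.
Qed.

Local Notation mu := (@lebesgue_measure R \x @lebesgue_measure R)%E.

(** The product measure is by definition the integral of the vertical sections. Uniqueness of the
    product measure allows the other order, the one suited to maps that act along horizontal
    lines. *)
Lemma leb2_ysection (A : set PM) : measurable A ->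
  mu A = (\int[lebesgue_measure]_y lebesgue_measure (ysection A y))%E.
Proof.
move=> mA; rewrite (@product_measure_unique _ _ _ _ _ _ _ (lebesgue_measure \x^ lebesgue_measure)%E) //.
by move=> A1 A2 mA1 mA2; exact: product_measure2E.
Qed.

Lemma leb2_xsection (A : set PM) : measurable A ->
  mu A = (\int[lebesgue_measure]_x lebesgue_measure (xsection A x))%E.
Proof. by []. Qed.

Definition shearx (g : R -> R) (x : P) : P := (x.1 + g x.2, x.2).
Definition sheary (g : R -> R) (x : P) : P := (x.1, x.2 + g x.1).

Definition preserves (f : PM -> PM) := measurable_fun setT f /\
  forall A : set PM, measurable A -> mu (f @^-1` A) = mu A.

Lemma preserves_comp f g : preserves f -> preserves g -> preserves (f \o g).
Proof.
move=> [mf f1] [mg g1]; split; first exact: measurableT_comp.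
move=> A mA; rewrite comp_preimage g1 ?f1//.
by rewrite -[X in measurable X]setTI; exact: mf.
Qed.

(** Cavalieri's principle: on each horizontal line the map is a translation by an amount that
    depends only on the line. *)
Lemma preserves_shearx g : measurable_fun setT g -> preserves (shearx g).
Proof.
move=> mg.
have mf : measurable_fun setT (shearx g : PM -> PM).
  apply/measurable_fun_pairP; split => /=; last exact: measurable_snd.
  apply: measurable_funD; first exact: measurable_fst.
  exact: measurableT_comp.
split => // A mA.
have mfA : measurable (shearx g @^-1` A : set PM).
  by rewrite -[X in measurable X]setTI; exact: mf.
rewrite !leb2_ysection//; apply: eq_integral => y _.
rewrite -[in RHS](@lebesgue_measure_shift (g y)); last exact: measurable_ysection.
by congr lebesgue_measure; apply/seteqP; split => x /=; rewrite !ysectionE.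
Qed.

Lemma preserves_sheary g : measurable_fun setT g -> preserves (sheary g).
Proof.
move=> mg.
have mf : measurable_fun setT (sheary g : PM -> PM).
  apply/measurable_fun_pairP; split => /=; first exact: measurable_fst.
  apply: measurable_funD; first exact: measurable_snd.
  exact: measurableT_comp.
split => // A mA.
have mfA : measurable (sheary g @^-1` A : set PM).
  by rewrite -[X in measurable X]setTI; exact: mf.
rewrite !leb2_xsection//; apply: eq_integral => y _.
rewrite -[in RHS](@lebesgue_measure_shift (g y)); last exact: measurable_xsection.
by congr lebesgue_measure; apply/seteqP; split => x /=; rewrite !xsectionE.
Qed.

Lemma preserves_negx : preserves (fun x => (- x.1, x.2)).
Proof.
have mf : measurable_fun setT ((fun x => (- x.1, x.2)) : PM -> PM).
  apply/measurable_fun_pairP; split => /=; last exact: measurable_snd.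
  by apply: measurable_funN; exact: measurable_fst.
split => // A mA.
rewrite !leb2_ysection//; last by rewrite -[X in measurable X]setTI; exact: mf.
apply: eq_integral => y _.
rewrite -[in RHS]lebesgue_measureN; last exact: measurable_ysection.
by rewrite /pushforward; congr lebesgue_measure; apply/seteqP; split => x /=; rewrite !ysectionE.
Qed.
End PlaneMeasure.

Section Refl.
Variable R : realType.
Notation P := (R * R)%type.
Notation PM := (measurableTypeR R * measurableTypeR R)%type.
Local Notation mu := (@lebesgue_measure R \x @lebesgue_measure R)%E.

Lemma preserves_negy : preserves (fun x : P => (x.1, - x.2)).
Proof.
have mf : measurable_fun setT ((fun x => (x.1, - x.2)) : PM -> PM).
  apply/measurable_fun_pairP; split => /=; first exact: measurable_fst.
  by apply: measurable_funN; exact: measurable_snd.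
split => // A mA.
rewrite !leb2_xsection//; last by rewrite -[X in measurable X]setTI; exact: mf.
apply: eq_integral => y _.
rewrite -[in RHS]lebesgue_measureN; last exact: measurable_xsection.
by rewrite /pushforward; congr lebesgue_measure; apply/seteqP; split => x /=; rewrite !xsectionE.
Qed.

Definition refl (e : P) (l : R) (y : P) : P :=
  psub y (pscale (2 * (dot y e - l)) e).

(* Off the coordinate axes, the linear part is a rotation, that is a product of
   three shears, after the reflection of the first coordinate. *)
Lemma preserves_refl (e : P) l : dot e e = 1 -> preserves (refl e l).
Proof.
move: e => [a b]; rewrite /dot /= => ab1.
have mlin c : measurable_fun setT (fun x : R => c * x).
  by apply: measurable_funM => //; exact: measurable_cst.
have mcst c : measurable_fun setT (fun x : R => c).
  exact: measurable_cst.
have [a0|a0] := eqVneq a 0.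
  have -> : refl (a, b) l = sheary (fun=> 2 * l * b) \o (fun x => (x.1, - x.2)).
    apply/funext => -[x y]; rewrite /refl /sheary /psub /pscale /dot /= a0.
    congr pair; first ring.
    have -> : y - 2 * (x * 0 + y * b - l) * b = - y * (a * a + b * b) + 2 * l * b + y * (1 - (a * a + b * b)) + y * 2 * a * a.
      by ring.
    by rewrite ab1 a0; ring.
  by apply: preserves_comp preserves_negy; exact: preserves_sheary.
have [b0|b0] := eqVneq b 0.
  have -> : refl (a, b) l = shearx (fun=> 2 * l * a) \o (fun x => (- x.1, x.2)).
    apply/funext => -[x y]; rewrite /refl /shearx /psub /pscale /dot /= b0.
    congr pair; last ring.
    have -> : x - 2 * (x * a + y * 0 - l) * a = - x * (a * a + b * b) + 2 * l * a + x * (1 - (a * a + b * b)) + x * 2 * b * b.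
      by ring.
    by rewrite ab1 b0; ring.
  by apply: preserves_comp; [exact: preserves_shearx|exact: preserves_negx].
(* For e = (cos t, sin t) the rotation is by the angle 2t; [w] is sin 2t and [u] is - tan t, the
   coefficients of its three shears. *)
pose w := 2 * a * b.
pose u := - b / a.
have -> : refl (a, b) l = (shearx (fun=> 2 * l * a) \o sheary (fun=> 2 * l * b)) \o
    ((shearx (fun x => u * x) \o sheary (fun x => w * x)) \o
      (shearx (fun x => u * x) \o (fun x => (- x.1, x.2)))).
  apply/funext => -[x y]; rewrite /refl /shearx /sheary /psub /pscale /dot /= /u /w.
  have bE : b * b = 1 - a * a by rewrite -ab1; ring.
  congr pair.
    rewrite (_ : - x + _ * y + _ + 2 * l * a = x * (-1 + 2 * (b * b)) - (b * y / a) * 2 * (1 - (b * b)) + 2 * l * a); last first.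
      by field.
    by rewrite bE; field.
  rewrite (_ : _ + 2 * l * b = y * (1 - 2 * (b * b)) - 2 * a * b * x + 2 * l * b); last first.
    by field.
  by ring.
apply: preserves_comp.
  by apply: preserves_comp; [exact: preserves_shearx|exact: preserves_sheary].
apply: preserves_comp.
  by apply: preserves_comp; [exact: preserves_shearx|exact: preserves_sheary].
by apply: preserves_comp; [exact: preserves_shearx|exact: preserves_negx].
Qed.

Lemma ge0_integral_preserves (f : PM -> PM) (D : set PM) (g : PM -> \bar R) :
  preserves f -> measurable D -> measurable_fun D g -> (forall x, D x -> 0 <= g x)%E ->
  (\int[mu]_(x in f @^-1` D) g (f x) = \int[mu]_(x in D) g x)%E.
Proof.
move=> [mf pf] mD mg g0.
have g0' : {in D, forall y, (0 <= g y)%E} by move=> x /set_mem; exact: g0.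
have H := ge0_integral_pushforward mf mu mD mg g0'.
refine (etrans (esym H) _).
by apply: eq_measure_integral => A mA _; exact: pf.
Qed.

Lemma refl_dot e l y : dot e e = 1 -> dot (refl e l y) e = 2 * l - dot y e.
Proof.
move=> e1; rewrite /refl.
have -> : dot (psub y (pscale (2 * (dot y e - l)) e)) e = dot y e - 2 * (dot y e - l) * dot e e.
  by rewrite /dot/psub/pscale/=; ring.
by rewrite e1; ring.
Qed.

Lemma reflK e l : dot e e = 1 -> involutive (refl e l).
Proof.
move=> e1 y; rewrite {1}/refl refl_dot// /refl /psub /pscale; case: y => a b /=.
by congr pair; ring.
Qed.

Lemma refl_dist e l x y : dot e e = 1 ->
  enorm (psub (refl e l x) (refl e l y)) = enorm (psub x y).
Proof.
move=> e1; congr Num.sqrt.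
pose t := dot x e - dot y e.
have tE : dot (psub x y) e = t by rewrite /t/dot/psub /=; ring.
transitivity (dot (psub x y) (psub x y) - 4 * t * dot (psub x y) e + 4 * t ^+ 2 * dot e e).
  by rewrite /t /refl/dot/psub/pscale /=; ring.
by rewrite e1 tE; ring.
Qed.

(** This identity serves twice: for [y] in [D] it compares the two logarithmic kernels, and for [y]
    the origin it gives the change of |z|^2 in the boundary equation. *)
Lemma enorm_refl_sub e l z y : dot e e = 1 ->
  enorm (psub z y) ^+ 2 - enorm (psub (refl e l z) y) ^+ 2 =
  4 * (dot z e - l) * (l - dot y e).
Proof.
move=> e1; rewrite !sqr_sqrtr ?addr_ge0 -?expr2 ?sqr_ge0//.
pose s := dot z e - l.
transitivity (4 * s * dot (psub z y) e - 4 * s ^+ 2 * dot e e).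
  by rewrite /s /refl/dot/psub/pscale /=; ring.
by rewrite e1 /s /dot /psub /=; ring.
Qed.

End Refl.

(** * The logarithmic potential *)

Section Singular.
Variable R : realType.
Notation P := (R * R)%type.
Notation PM := (measurableTypeR R * measurableTypeR R)%type.
Local Notation mu := (@lebesgue_measure R \x @lebesgue_measure R)%E.

Lemma dot_ge0 (x : P) : 0 <= dot x x.
Proof. by rewrite addr_ge0// -expr2 sqr_ge0. Qed.

Lemma enorm_ge0 (x : P) : 0 <= enorm x.
Proof. exact: sqrtr_ge0. Qed.

Lemma sqr_enorm (x : P) : enorm x ^+ 2 = dot x x.
Proof. by rewrite sqr_sqrtr// dot_ge0. Qed.

Lemma enorm_fst (x : P) : `|x.1| <= enorm x.
Proof. by rewrite -sqrtr_sqr ler_wsqrtr// /dot -expr2 lerDl -expr2 sqr_ge0. Qed.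

Lemma enorm_snd (x : P) : `|x.2| <= enorm x.
Proof. by rewrite -sqrtr_sqr ler_wsqrtr// /dot -!expr2 lerDr sqr_ge0. Qed.

Lemma enorm_le_l1 (x : P) : enorm x <= `|x.1| + `|x.2|.
Proof.
rewrite -[leRHS]ger0_norm ?addr_ge0// -sqrtr_sqr ler_wsqrtr// /dot sqrrD.
by rewrite !real_normK ?num_real// -!expr2 lerD2r lerDl mulrn_wge0// mulr_ge0.
Qed.

Lemma enorm_eq0 (x y : P) : enorm (psub x y) = 0 -> x = y.
Proof.
case: x y => [a b] [c d] h.
have := enorm_fst (psub (a, b) (c, d)); have := enorm_snd (psub (a, b) (c, d)).
by rewrite h !normr_le0 !subr_eq0 /= => /eqP -> /eqP ->.
Qed.

Lemma enorm_gt0 (x y : P) : x <> y -> 0 < enorm (psub x y).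
Proof. by move=> xy; rewrite lt_def enorm_ge0 andbT; apply/eqP => /enorm_eq0. Qed.

Lemma measurable_dist (z : P) :
  measurable_fun setT (fun y : PM => enorm (psub z y)).
Proof.
rewrite (_ : (fun y : PM => _) = (fun y : PM => (dot (psub z y) (psub z y)) `^ 2^-1)); last first.
  by apply/funext => y; rewrite powR12_sqrt// dot_ge0.
apply: (measurableT_comp (measurable_powR _)).
by apply: measurable_funD; apply: measurable_funM; apply: measurable_funB => //;
  try exact: measurable_cst; try exact: measurable_fst; exact: measurable_snd.
Qed.

Lemma measurable_invdist (z : P) :
  measurable_fun setT (fun y : PM => (enorm (psub z y))^-1).
Proof.
rewrite (_ : (fun y : PM => _) = (fun y : PM => (enorm (psub z y)) `^ (-1))); last first.
  by apply/funext => y; rewrite powR_inv1// enorm_ge0.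
exact: (measurableT_comp (measurable_powR _) (measurable_dist z)).
Qed.

Lemma measurable_lndist (z : P) :
  measurable_fun setT (fun y : PM => ln (enorm (psub z y))).
Proof. exact: (measurableT_comp (@measurable_ln R) (measurable_dist z)). Qed.

Definition box (z : P) (r : R) : set PM :=
  `[z.1 - r, z.1 + r]%classic `*` `[z.2 - r, z.2 + r]%classic.

Lemma boxE z r y : enorm (psub z y) <= r -> box z r y.
Proof.
move=> h; have h1 := le_trans (enorm_fst _) h; have h2 := le_trans (enorm_snd _) h.
by split; rewrite /= in_itv /=; move: h1 h2; rewrite !ler_norml /= => /andP[? ?] /andP[? ?]; apply/andP; split; lra.
Qed.

Lemma measurable_box z r : measurable (box z r).
Proof. by apply: measurableX; exact: measurable_itv. Qed.

Lemma measure_box z r : 0 <= r -> mu (box z r) = ((2 * r) ^+ 2)%:E.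
Proof.
move=> r0; rewrite product_measure1E; try exact: measurable_itv.
have h a : lebesgue_measure `[a - r, a + r]%classic = (2 * r)%:E.
  rewrite lebesgue_measure_itv /= lte_fin; case: ifPn => h.
    by rewrite -EFinB; congr EFin; ring.
  by congr EFin; move: h; rewrite -leNgt => ?; lra.
by rewrite expr2 EFinM; congr (_ * _)%E; exact: h.
Qed.

(* Dyadic boxes: if 2^n <= 1/|z - y| < 2^(n+1) then y lies in the box of
   radius 2^-n around z, whose area is 4/4^n. *)
Lemma integral_invdist_le (D : set PM) (z : P) : measurable D ->
  (\int[mu]_(y in D) ((enorm (psub z y))^-1)%:E <= mu D + 16%:E)%E.
Proof.
move=> mD.
pose u n (y : PM) : \bar R := ((2 * 2 ^+ n) * \1_(box z ((2 ^+ n)^-1)) y)%:E.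
have u0 n y : (0 <= u n y)%E.
  by rewrite lee_fin mulr_ge0// mulr_ge0// exprn_ge0.
have mu_ n : measurable_fun D (u n).
  apply/measurable_EFinP; apply: measurable_funM; first exact: measurable_cst.
  by apply: measurable_indic; exact: measurable_box.
have ms : measurable_fun D (fun y => \sum_(0 <= n <oo) u n y)%E.
  exact: (@ge0_emeasurable_sum _ _ _ _ u xpredT).
have s0 y : (0 <= \sum_(0 <= n <oo) u n y)%E by apply: nneseries_ge0.
apply: (@le_trans _ _ (\int[mu]_(y in D) (cst 1%:E y + \sum_(0 <= n <oo) u n y))%E).
  apply: ge0_le_integral => //.
  - by move=> y _; rewrite lee_fin invr_ge0 enorm_ge0.
  - apply/measurable_EFinP; apply: measurable_funTS; exact: measurable_invdist.
  - by apply: emeasurable_funD; [exact: measurable_cst|exact: ms].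
  move=> y _ /=; set r := enorm _.
  have r0 : 0 <= r := enorm_ge0 _.
  have [r1|r1] := lerP 1 r.
    apply: (@le_trans _ _ 1%:E); first by rewrite lee_fin invf_le1// (lt_le_trans _ r1).
    by rewrite leeDl.
  have [->|rn0] := eqVneq r 0; first by rewrite invr0 adde_ge0.
  have rp : 0 < r by rewrite lt_def rn0.
  have ex : exists n, r^-1 < 2 ^+ n.+1.
    exists (Num.Def.archi_bound r^-1); apply: upper_nthrootP; exact: leqnSn.
  case: (ex_minnP ex) => n rn minn.
  have bn : box z ((2 ^+ n)^-1) y.
    apply: boxE; rewrite -/r.
    case: n rn minn => [_ _|n _ minn]; first by rewrite expr0 invr1 ltW.
    rewrite -[r]invrK lef_pV2 ?posrE ?invr_gt0 ?exprn_gt0//.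
    by rewrite leNgt; apply/negP => /minn; rewrite ltnn.
  apply: (@le_trans _ _ (u n y)).
    rewrite /u indicE mem_set// mulr1 lee_fin -exprS ltW//.
  apply: (@le_trans _ _ (\sum_(0 <= i < n.+1) u i y)%E).
    rewrite big_nat_recr //= leeDr//; apply: sume_ge0 => *; exact: u0.
  apply: le_trans; first exact: (nneseries_lim_ge (P := xpredT)).
  by rewrite leeDr.
rewrite ge0_integralD//.
rewrite integral_cst// mul1e leeD2l//.
rewrite integral_nneseries//.
(* The n-th box contributes at most 2 * 2^n * 4/4^n = 16/2^(n+1), and these sum to 16. *)
have lim16 := cvg_lim _ (@cvg_geometric_eseries_half R 16 0).
rewrite -[leRHS]mule1 -[X in (_ * X)%E]/(1%:E) -EFinM mulr1 -[X in X%:E]divr1 -[X in (_ / X)](expr0 2) -lim16//.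
apply: lee_nneseries => [n _ _|n _]; first by apply: integral_ge0 => y _; exact: u0.
rewrite /u; under eq_integral do rewrite EFinM.
have mi : measurable_fun D (fun y => (\1_(box z ((2 ^+ n)^-1)) y)%:E : \bar R).
  by apply/measurable_EFinP; apply: measurable_indic; exact: measurable_box.
have c0 : 0 <= 2 * 2 ^+ n :> R by rewrite mulr_ge0// exprn_ge0.
rewrite (ge0_integralZl_EFin _ mD _ mi c0)//.
rewrite integral_indic//; last exact: measurable_box.
apply: (@le_trans _ _ ((2 * 2 ^+ n)%:E * mu (box z ((2 ^+ n)^-1)))%E).
  rewrite lee_pmul2l// ?lte_fin ?mulr_gt0 ?exprn_gt0//.
  apply: le_measure; rewrite ?inE; [|exact: measurable_box|exact: subIsetl].
  by apply: measurableI => //; exact: measurable_box.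
rewrite measure_box ?invr_ge0 ?exprn_ge0// -EFinM lee_fin addn1 natrX (exprS 2 n).
have : 0 < 2 ^+ n :> R by rewrite exprn_gt0.
move: (2 ^+ n) => t t0; rewrite le_eqVlt; apply/orP; left; apply/eqP.
by field; rewrite gt_eqF.
Qed.

End Singular.

(** * Integrals of functions odd under a reflection *)

Section Reflection.
Variable R : realType.
Notation P := (R * R)%type.
Notation PM := (measurableTypeR R * measurableTypeR R)%type.
Local Notation mu := (@lebesgue_measure R \x @lebesgue_measure R)%E.

Lemma measurable_dot (e : P) : measurable_fun setT (fun y : PM => dot y e).
Proof.
by apply: measurable_funD; apply: measurable_funM;
  try exact: measurable_cst; try exact: measurable_fst; exact: measurable_snd.
Qed.

(** The negative part of [m] lives on the cap [D] /\ [H], since [m] vanishes on the line by oddness.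
    The reflection turns its integral into that of the positive part over the mirror image [E] of
    the cap, and [E] lies in [D]; hence the positive part of [m] outweighs the negative one. *)
Lemma odd_integral_ge0 (D : set PM) (e : P) l (m : PM -> R) :
  measurable D -> dot e e = 1 ->
  (forall y, D y -> l < dot y e -> D (refl e l y)) ->
  measurable_fun setT m -> mu.-integrable D (EFin \o m) ->
  (forall y, m (refl e l y) = - m y) ->
  (forall y, D y -> dot y e < l -> 0 <= m y) ->
  0 <= Rintegral mu D m.
Proof.
move=> mD e1 Dl mm im modd mge.
have [mr pr] := preserves_refl l e1.
pose H : set PM := [set y | l < dot y e].
have mH : measurable H.
  rewrite (_ : H = (fun y : PM => dot y e) @^-1` `]l, +oo[); last first.
    by apply/seteqP; split => y /=; rewrite in_itv /= andbT.
  rewrite -[X in measurable X]setTI.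
  exact: (measurable_dot e measurableT (measurable_itv _)).
have mDH : measurable (D `&` H) by exact: measurableI.
pose E : set PM := refl e l @^-1` (D `&` H).
have mE : measurable E by rewrite -[X in measurable X]setTI; exact: mr.
have ED : E `<=` D.
  by move=> y [Dy Hy]; rewrite -(reflK l e1 y); exact: Dl.
have mp A : measurable_fun A (fun y => (EFin \o m)^\+%E y).
  apply: measurable_funTS; apply: measurable_funepos; exact/measurable_EFinP.
apply: fine_ge0; rewrite integralE sube_ge0 ?integrable_neg_fin_num//.
have -> : (\int[mu]_(x in D) (EFin \o m)^\- x = \int[mu]_(x in D `&` H) (EFin \o m)^\- x)%E.
  rewrite [RHS]integral_mkcondr; apply: eq_integral => y /set_mem Dy.
  rewrite patchE; case: ifPn => //; rewrite notin_setE /H /= => /negP.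
  rewrite -leNgt funenegE /= -EFin_max => yl.
  congr EFin; apply/max_r; rewrite oppr_le0.
  move: yl; rewrite le_eqVlt => /orP[/eqP yl|]; last exact: mge.
  have := modd y; rewrite (_ : refl e l y = y); last first.
    by rewrite /refl yl subrr mulr0 /psub /pscale !mul0r !subr0; case: (y).
  by move=> h; lra.
have -> : (\int[mu]_(x in D `&` H) (EFin \o m)^\- x = \int[mu]_(x in E) (EFin \o m)^\+ x)%E.
  have pE : forall y, E y -> (0 <= (EFin \o m)^\+%E y)%E by [].
  rewrite -(ge0_integral_preserves (preserves_refl l e1) mE (mp E) pE).
  have -> : refl e l @^-1` E = D `&` H.
    by apply/seteqP; split => y; rewrite /E /= reflK.
  by apply: eq_integral => y _; rewrite funenegE funeposE /= modd.
apply: ge0_subset_integral => //.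
Qed.
End Reflection.

(** * Integrability and Lipschitz bound for the stream function *)

Section Stream.
Variable R : realType.
Notation P := (R * R)%type.
Notation PM := (measurableTypeR R * measurableTypeR R)%type.
Local Notation mu := (@lebesgue_measure R \x @lebesgue_measure R)%E.
Variable D : set PM.
Hypotheses (mD : measurable D) (bD : pbounded D).

Lemma pbounded_measure_lty : (mu D < +oo)%E.
Proof.
case: bD => M DM.
apply: (@le_lt_trans _ _ (mu (box (0, 0) `|M|))).
  apply: le_measure; rewrite ?inE//; first exact: measurable_box.
  move=> y Dy; apply: boxE.
  have -> : enorm (psub (0, 0) y) = enorm y.
    by congr Num.sqrt; rewrite /dot /psub /=; ring.
  exact: le_trans (DM y Dy) (ler_norm _).
by rewrite measure_box// ltry.
Qed.

(** The bound of [integral_invdist_le] as a real number. It does not depend on the pole [z], so the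
    Lipschitz constant of [stream] is uniform. *)
Definition invdist_bound : R := fine (mu D) + 16.

Lemma integrable_invdist z :
  mu.-integrable D (EFin \o (fun y => (enorm (psub z y))^-1)).
Proof.
apply/integrableP; split.
  apply/measurable_EFinP; apply: measurable_funTS; exact: measurable_invdist.
apply: le_lt_trans (_ : mu D + 16%:E < +oo)%E; last first.
  by rewrite lte_add_pinfty ?ltry// pbounded_measure_lty.
apply: le_trans (integral_invdist_le z mD).
rewrite le_eqVlt; apply/orP; left; apply/eqP; apply: eq_integral => y _ /=.
by rewrite ger0_norm// invr_ge0 enorm_ge0.
Qed.

Lemma Rintegral_invdist_le z :
  Rintegral mu D (fun y => (enorm (psub z y))^-1) <= invdist_bound.
Proof.
have h : mu D \is a fin_num by rewrite ge0_fin_numE// pbounded_measure_lty.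
rewrite /invdist_bound -[16]/(fine 16%:E) -fineD//.
apply: fine_le.
- exact: integrable_fin_num (integrable_invdist z).
- by rewrite fin_numD h.
- exact: integral_invdist_le.
Qed.

Lemma integrable_bounded (f : PM -> R) (K : R) : measurable_fun setT f ->
  (forall y, D y -> `|f y| <= K) -> mu.-integrable D (EFin \o f).
Proof.
move=> mf fK; apply: measurable_bounded_integrable => //.
- exact: pbounded_measure_lty.
- exact: measurable_funTS.
- exists K; split; first exact: num_real.
  by move=> x xK y Dy; apply: le_trans (fK y Dy) (ltW xK).
Qed.

Lemma ln_le_sub1 (x : R) : 0 < x -> ln x <= x - 1.
Proof. by move=> x0; rewrite -{1}[x](subrKC 1); apply: le_ln1Dx; lra. Qed.

(** Apply ln t <= t - 1 to t = x and to t = 1/x. With ln 0 = 0 and 0^-1 = 0 the bound also holds at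
    0, so the pole need not be removed from the domain of integration. *)
Lemma abs_ln_le (x : R) : 0 <= x -> `|ln x| <= x^-1 + x.
Proof.
move=> x0; have [->|xn] := eqVneq x 0; first by rewrite ln0// normr0 invr0 addr0.
have xp : 0 < x by rewrite lt_def xn.
have h1 := ln_le_sub1 xp.
have ip : 0 < x^-1 by rewrite invr_gt0.
have := ln_le_sub1 ip; rewrite lnV ?posrE// => h2.
by rewrite ler_norml; apply/andP; split; lra.
Qed.

Lemma integrable_lndist z :
  mu.-integrable D (EFin \o (fun y => ln (enorm (psub z y)))).
Proof.
case: bD => M DM.
pose K := `|z.1| + `|z.2| + 2 * M.
have iK : mu.-integrable D (EFin \o (fun=> K)).
  by apply: (@integrable_bounded _ `|K|) => //; exact: measurable_cst.
apply: (le_integrable mD _ _ (integrableD mD (integrable_invdist z) iK)).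
  apply/measurable_EFinP; apply: measurable_funTS; exact: measurable_lndist.
move=> y Dy /=; rewrite lee_fin.
apply: (le_trans (abs_ln_le (enorm_ge0 _))).
apply: le_trans (ler_norm _); rewrite lerD2l /K.
apply: (le_trans (enorm_le_l1 _)) => /=.
have := enorm_fst y; have := enorm_snd y; have := DM y Dy.
have := ler_normB z.1 y.1; have := ler_normB z.2 y.2.
by lra.
Qed.

(** Multiply by |a| + |b|: the left side becomes a difference of squares, which factors coordinate
    by coordinate. *)
Lemma sub_enorm_le (a b : P) : enorm a - enorm b <= `|a.1 - b.1| + `|a.2 - b.2|.
Proof.
have a0 := enorm_ge0 a; have b0 := enorm_ge0 b.
have [h|h] := lerP (enorm a + enorm b) 0.
  have -> : enorm a = 0 by lra.
  by rewrite sub0r (le_trans _ (addr_ge0 _ _))// oppr_le0.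
rewrite -(ler_pM2r h) -subr_sqr !sqr_enorm.
have -> : dot a a - dot b b = (a.1 - b.1) * (a.1 + b.1) + (a.2 - b.2) * (a.2 + b.2).
  by rewrite /dot; ring.
rewrite [leRHS]mulrDl; apply: lerD; apply: (le_trans (ler_norm _)); rewrite normrM ler_wpM2l//;
  apply: (le_trans (ler_normD _ _)); apply: lerD; solve [exact: enorm_fst | exact: enorm_snd].
Qed.

(** The working distance for all local arguments: it is comparable to both the max norm and the
    Euclidean norm, and its estimates are linear. *)
Definition l1 (x : P) : R := `|x.1| + `|x.2|.

(** One side follows from ln (p/q) <= (p - q)/q with p, q the two distances to [y]. The sum of both
    reciprocals makes the bound symmetric in [z] and [w]. *)
Lemma dist_ln_le (z w y : P) : z <> y -> w <> y ->
  `|ln (enorm (psub z y)) - ln (enorm (psub w y))| <=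
  l1 (psub z w) * ((enorm (psub z y))^-1 + (enorm (psub w y))^-1).
Proof.
have main (a b : P) : a <> y -> b <> y ->
   ln (enorm (psub a y)) - ln (enorm (psub b y)) <=
   l1 (psub a b) * ((enorm (psub a y))^-1 + (enorm (psub b y))^-1).
  move=> /enorm_gt0 ay /enorm_gt0 by_.
  rewrite -ln_div ?posrE//.
  apply: (le_trans (ln_le_sub1 (divr_gt0 ay by_))).
  have -> : enorm (psub a y) / enorm (psub b y) - 1 =
     (enorm (psub a y) - enorm (psub b y)) / enorm (psub b y).
    by field; rewrite gt_eqF.
  apply: (@le_trans _ _ (l1 (psub a b) / enorm (psub b y))).
    rewrite ler_pM2r ?invr_gt0//; apply: (le_trans (sub_enorm_le _ _)).
    by rewrite /l1 /psub /= !opprB !addrA !subrK.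
  by rewrite ler_wpM2l ?addr_ge0// lerDr invr_ge0 enorm_ge0.
move=> zy wy; rewrite ler_norml; apply/andP; split; last exact: main.
rewrite lerNl opprB; apply: (le_trans (main _ _ wy zy)).
by rewrite addrC /l1 /psub /= (distrC z.1) (distrC z.2).
Qed.

(* Only for points outside D: at y = z the library has ln 0 = 0 and 0^-1 = 0,
   which breaks the pointwise bound of the integrands. *)
Lemma stream_lipschitz (z w : P) : ~ D z -> ~ D w ->
  `|stream D z - stream D w| <= pi^-1 * invdist_bound * l1 (psub z w).
Proof.
move=> Dz Dw; rewrite /stream /leb2 -mulrBr -RintegralB//; try exact: integrable_lndist.
have p0 : 0 < (2 * pi)^-1 :> R by rewrite invr_gt0 mulr_gt0// pi_gt0.
rewrite normrM (gtr0_norm p0) (_ : pi^-1 * _ * _ = (2 * pi)^-1 * (l1 (psub z w) * (invdist_bound + invdist_bound))); last first.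
  by move: (pi_gt0 R); move: (@pi R) => p p_gt0; field; rewrite gt_eqF.
rewrite ler_pM2l//.
have iB := integrableB mD (integrable_lndist z) (integrable_lndist w).
have iD := integrableD mD (integrable_invdist z) (integrable_invdist w).
apply: le_trans (le_normr_Rintegral mD iB) _.
apply: (@le_trans _ _ (Rintegral mu D (fun y => l1 (psub z w) * ((enorm (psub z y))^-1 + (enorm (psub w y))^-1)))).
  apply: le_Rintegral => //.
  - exact: integrable_norm iB.
  - exact: (integrableZl mD (l1 (psub z w)) iD).
  - move=> y Dy; apply: dist_ln_le => zy; [apply: Dz|apply: Dw]; by rewrite zy.
rewrite (RintegralZl _ mD iD) ler_wpM2l ?addr_ge0// RintegralD//; try exact: integrable_invdist.
by apply: lerD; exact: Rintegral_invdist_le.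
Qed.

End Stream.

(** * Lower bound for the potential difference of mirror points *)

Section Hopf.
Variable R : realType.
Notation P := (R * R)%type.
Notation PM := (measurableTypeR R * measurableTypeR R)%type.
Local Notation mu := (@lebesgue_measure R \x @lebesgue_measure R)%E.
Variables (D : set PM) (e : P) (l : R).
Hypotheses (mD : measurable D) (bD : pbounded D) (barD : barycenter_zero D).
Hypothesis e1 : dot e e = 1.

(** The linear part integrates to 0 because the barycenter is the origin. *)
Lemma Rintegral_affine :
  Rintegral mu D (fun y => l - dot y e) = l * fine (mu D).
Proof.
case: bD => M DM.
have ib (f : PM -> R) c : measurable_fun setT f -> (forall y, `|f y| <= enorm y) ->
    mu.-integrable D (EFin \o (fun y => c * f y)).
  move=> mf fb; apply: (@integrable_bounded _ _ mD bD _ (`|c| * M)).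
    by apply: measurable_funM => //; exact: measurable_cst.
  by move=> y Dy; rewrite normrM ler_wpM2l// (le_trans (fb y))// DM.
have i1 := ib _ 1 measurable_fst (@enorm_fst R).
have i2 := ib _ 1 measurable_snd (@enorm_snd R).
have j1 := ib _ e.1 measurable_fst (@enorm_fst R).
have j2 := ib _ e.2 measurable_snd (@enorm_snd R).
have il : mu.-integrable D (EFin \o (fun=> l)).
  by apply: (@integrable_bounded _ _ mD bD _ `|l|) => //; exact: measurable_cst.
have [b1 b2] := barD.
have k1 : mu.-integrable D (EFin \o (fun y : PM => y.1)).
  by apply: eq_integrable i1 => // y _ /=; rewrite mul1r.
have k2 : mu.-integrable D (EFin \o (fun y : PM => y.2)).
  by apply: eq_integrable i2 => // y _ /=; rewrite mul1r.
rewrite (_ : (fun y => _) = (fun y : PM => l - (e.1 * y.1 + e.2 * y.2))); last first.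
  by apply/funext => y; rewrite /dot; ring.
rewrite RintegralB//; last exact: (integrableD mD j1 j2).
rewrite RintegralD// !RintegralZl//.
move: b1 b2; rewrite /leb2 => -> ->.
rewrite !mulr0 addr0 subr0 Rintegral_cst//.
Qed.

Lemma stream_refl_ge (z : P) (K : R) :
  (forall y, D y -> l < dot y e -> D (refl e l y)) ->
  l < dot z e -> ~ D z -> ~ D (refl e l z) -> 0 < K ->
  (forall y, D y -> enorm (psub z y) ^+ 2 <= K) ->
  (pi * K)^-1 * ((dot z e - l) * (l * fine (mu D))) <=
    stream D z - stream D (refl e l z).
Proof.
move=> Dl zl Dz Drz K0 DK.
pose s := dot z e - l.
have s0 : 0 < s by rewrite subr_gt0.
(* The affine function c (l - y.e) is odd under the reflection, like the kernel difference [k]. The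
   factor [c] is small enough to keep it below [k] on {y.e < l}, so [odd_integral_ge0] applies to
   [m]. *)
pose c := 2 * s / K.
pose k y := ln (enorm (psub z y)) - ln (enorm (psub (refl e l z) y)).
pose m (y : PM) := k y - c * (l - dot y e).
have ik : mu.-integrable D (EFin \o k).
  exact: (integrableB mD (integrable_lndist mD bD z) (integrable_lndist mD bD _)).
have ma : measurable_fun setT (fun y : PM => l - dot y e).
  by apply: measurable_funB; [exact: measurable_cst|exact: measurable_dot].
have ia : mu.-integrable D (EFin \o (fun y : PM => l - dot y e)).
  case: (bD) => M DM; apply: (@integrable_bounded _ _ mD bD _ (`|l| + (M * `|e.1| + M * `|e.2|))) => //.
  move=> y Dy; apply: (le_trans (ler_normB _ _)); rewrite lerD2l.
  apply: (le_trans (ler_normD _ _)); rewrite !normrM; apply: lerD; rewrite ler_wpM2r//.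
    exact: le_trans (enorm_fst y) (DM _ Dy).
  exact: le_trans (enorm_snd y) (DM _ Dy).
have ic : mu.-integrable D (EFin \o (fun y : PM => c * (l - dot y e))) := integrableZl mD c ia.
have m0 : 0 <= Rintegral mu D m.
  apply: (odd_integral_ge0 mD e1 Dl).
  - apply: measurable_funB.
      by apply: measurable_funB; exact: measurable_lndist.
    by apply: measurable_funM => //; exact: measurable_cst.
  - exact: (integrableB mD ik ic).
  - move=> y; rewrite /m /k refl_dot// refl_dist//.
    by rewrite -{1}(reflK l e1 z) refl_dist//; ring.
  - move=> y Dy yl.
    have a0 : 0 < enorm (psub z y) by apply: enorm_gt0 => zy; apply: Dz; rewrite zy.
    have b0 : 0 < enorm (psub (refl e l z) y).
      by apply: enorm_gt0 => zy; apply: Drz; rewrite zy.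
    have := enorm_refl_sub l z y e1; have := DK _ Dy.
    rewrite -/s /m /k.
    move: (enorm (psub z y)) (enorm (psub (refl e l z) y)) a0 b0 => a b a0 b0 aK ab.
    pose d := l - dot y e.
    have d0 : 0 < d by rewrite subr_gt0.
    have r0 : 0 < b / a by rewrite divr_gt0.
    (* Taking the logarithm of (b/a)^2 brings in the squared distances, whose difference is
       explicit: 2 (ln b - ln a) <= - 4 s d / a^2 <= - 4 s d / K. *)
    have := ln_le_sub1 (mulr_gt0 r0 r0).
    rewrite lnM ?posrE// ln_div ?posrE// => h.
    have h2 : b / a * (b / a) - 1 = - (4 * s * d / a ^+ 2).
      by rewrite /d -ab; field; rewrite gt_eqF.
    have h3 : 4 * s * d / K <= 4 * s * d / a ^+ 2.
      by rewrite ler_pM2l ?mulr_gt0// lef_pV2 ?posrE// exprn_gt0.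
    rewrite -/d /c (_ : 2 * s / K * d = 4 * s * d / K / 2); last by field; rewrite gt_eqF.
    lra.
move: m0; rewrite /m RintegralB// RintegralZl// Rintegral_affine /k.
rewrite RintegralB//; try exact: integrable_lndist.
rewrite /stream /leb2 -mulrBr -/s.
have p0 : 0 < (2 * pi)^-1 :> R by rewrite invr_gt0 mulr_gt0// pi_gt0.
rewrite (_ : (pi * K)^-1 * _ = (2 * pi)^-1 * (c * (l * fine (mu D)))); last first.
  rewrite /c; move: (pi_gt0 R); move: (@pi R) => p p_gt0; field.
  by rewrite !gt_eqF.
by rewrite ler_pM2l// -subr_ge0.
Qed.

Lemma measure_open_gt0 : open (D : set P) -> D !=set0 -> 0 < fine (mu D).
Proof.
move=> oD [x Dx].
have fmu : mu D \is a fin_num by rewrite ge0_fin_numE// (pbounded_measure_lty mD bD).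
move: oD; rewrite openE => /(_ x Dx) /nbhs_boxP [r r0 rD].
apply: fine_gt0; rewrite (pbounded_measure_lty mD bD) andbT.
apply: (@lt_le_trans _ _ (mu (box x (r / 2)))).
  by rewrite measure_box ?lte_fin ?exprn_gt0 ?divr_ge0 ?mulr_gt0 ?divr_gt0// ltW.
apply: le_measure; rewrite ?inE//; first exact: measurable_box.
move=> y [] /=; rewrite !in_itv /= => /andP[? ?] /andP[? ?].
by apply: rD; rewrite ltr_norml; apply/andP; split; lra.
Qed.

End Hopf.

(** * Boundary charts *)

Section Chart.
Variable R : realType.
Notation P := (R * R)%type.

Lemma openP_l1 (D : set P) x : open D -> D x ->
  exists2 r : R, 0 < r & forall y, l1 (psub y x) < r -> D y.
Proof.
rewrite openE => /(_ x) h /h /nbhs_boxP [r r0 rD]; exists r => // y yr.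
apply: rD; apply: le_lt_trans yr; rewrite /l1 /=; first by rewrite lerDl.
by rewrite lerDr.
Qed.

Lemma notin_closure_l1 (D : set P) x : ~ closure D x ->
  exists2 r : R, 0 < r & forall y, l1 (psub y x) < r -> ~ D y.
Proof.
move=> ncl; have : ~ (forall B : set P, nbhs x B -> D `&` B !=set0) by [].
move=> /existsNP [B /not_implyP [/nbhs_boxP [r r0 rB] nDB]]; exists r => // y yr Dy.
apply: nDB; exists y; split => //; apply: rB; apply: le_lt_trans yr; rewrite /l1 /=.
  by rewrite lerDl.
by rewrite lerDr.
Qed.

Lemma closureP_l1 (D : set P) x :
  closure D x <-> forall r : R, 0 < r -> exists2 y, D y & l1 (psub y x) < r.
Proof.
split.
  move=> clx r r0.
  have [|y [Dy [y1 y2]]] := clx [set y : P | `|y.1 - x.1| < r / 2 /\ `|y.2 - x.2| < r / 2].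
    by apply/nbhs_boxP; exists (r / 2) => //; rewrite divr_gt0.
  by exists y => //; rewrite /l1 /=; lra.
move=> h B /nbhs_boxP [r r0 rB]; have [y Dy yr] := h r r0.
exists y; split => //; apply: rB; apply: le_lt_trans yr; rewrite /l1 /=.
  by rewrite lerDl.
by rewrite lerDr.
Qed.

Lemma l1_ge0 (x : P) : 0 <= l1 x.
Proof. by rewrite addr_ge0. Qed.

Lemma unit_coord (e : P) : dot e e = 1 -> `|e.1| <= 1 /\ `|e.2| <= 1.
Proof.
move=> e1; have h : enorm e = 1 by rewrite /enorm e1 sqrtr1.
by split; rewrite -h; [exact: enorm_fst|exact: enorm_snd].
Qed.

Lemma dot_le_l1 (e x : P) : dot e e = 1 -> `|dot x e| <= l1 x.
Proof.
move=> /unit_coord [e1 e2]; apply: (le_trans (ler_normD _ _)).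
by rewrite !normrM; apply: lerD; rewrite ler_piMr.
Qed.

Lemma l1_scale (e : P) a : dot e e = 1 -> l1 (pscale a e) <= 2 * `|a|.
Proof.
move=> /unit_coord [e1 e2]; rewrite /l1 /= !normrM.
have := ler_wpM2l (normr_ge0 a) e1; have := ler_wpM2l (normr_ge0 a) e2; lra.
Qed.

Lemma l1D (x y : P) : l1 (padd x y) <= l1 x + l1 y.
Proof.
by rewrite /l1 /= addrACA; apply: lerD; exact: ler_normD.
Qed.

(** Joint continuity of the reflection in the point and in the level, needed because the plane is
    perturbed together with the point. *)
Lemma l1_refl (e : P) l l' y x : dot e e = 1 ->
  l1 (psub (refl e l y) (refl e l' x)) <= 5 * l1 (psub y x) + 4 * `|l - l'|.
Proof.
move=> e1.
have -> : psub (refl e l y) (refl e l' x) =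
    padd (psub y x) (pscale (- 2 * (dot (psub y x) e - (l - l'))) e).
  by rewrite /refl /psub /padd /pscale /dot /=; congr pair; ring.
apply: (le_trans (l1D _ _)).
have := l1_scale (- 2 * (dot (psub y x) e - (l - l'))) e1.
have := dot_le_l1 (psub y x) e1.
have := ler_normB (dot (psub y x) e) (l - l').
rewrite normrM normrN (@ger0_norm _ 2)//.
by lra.
Qed.

Lemma l1_le_enorm (y : P) : l1 y <= 2 * enorm y.
Proof. by have := enorm_fst y; have := enorm_snd y; rewrite /l1; lra. Qed.

Definition chart (x nu : P) (s t : R) : P :=
  padd x (padd (pscale s (perp nu)) (pscale t nu)).

Lemma chartE (x nu y : P) : dot nu nu = 1 ->
  y = chart x nu (dot (psub y x) (perp nu)) (dot (psub y x) nu).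
Proof.
rewrite /chart /padd /pscale /perp /dot /psub /=; case: y x nu => [y1 y2] [x1 x2] [a b] /= h.
congr pair.
  by transitivity (x1 + (y1 - x1) * (a * a + b * b)); [rewrite h; ring|ring].
by transitivity (x2 + (y2 - x2) * (a * a + b * b)); [rewrite h; ring|ring].
Qed.

Lemma dot_perp (nu : P) : dot (perp nu) (perp nu) = dot nu nu.
Proof. by rewrite /dot /perp /=; ring. Qed.

Lemma l1_chart (x nu : P) s t s' t' : dot nu nu = 1 ->
  l1 (psub (chart x nu s t) (chart x nu s' t')) <= 2 * `|s - s'| + 2 * `|t - t'|.
Proof.
move=> nu1; have p1 : dot (perp nu) (perp nu) = 1 by rewrite dot_perp.
have -> : psub (chart x nu s t) (chart x nu s' t') =
    padd (pscale (s - s') (perp nu)) (pscale (t - t') nu).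
  by rewrite /chart /psub /padd /pscale /perp /=; congr pair; ring.
by apply: (le_trans (l1D _ _)); apply: lerD; exact: l1_scale.
Qed.

Lemma chart0 (x nu : P) : chart x nu 0 0 = x.
Proof. by case: x => a b; rewrite /chart /padd /pscale /=; congr pair; ring. Qed.

(** The form in which C^1 regularity is used: since f' is continuous with f' 0 = 0, the mean value
    theorem makes [f] Lipschitz near 0 with as small a constant as desired. The ball of the chart is
    replaced by a square in the coordinates (s, t). *)
Lemma outward_normal_chart (D : set P) (x nu : P) : is_outward_normal D x nu ->
  dot nu nu = 1 /\ exists f : R -> R, f 0 = 0 /\
  (forall eps, 0 < eps -> exists2 rho, 0 < rho &
     forall s s', `|s| < rho -> `|s'| < rho -> `|f s - f s'| <= eps * `|s - s'|) /\
  exists2 r, 0 < r & forall s t, `|s| < r -> `|t| < r ->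
     (D (chart x nu s t) <-> t < f s).
Proof.
move=> [nu1 [r [r0 [f [f0 df cf f'0 Df]]]]].
have nu1' : dot nu nu = 1 by rewrite -sqr_enorm nu1 expr1n.
split=> //; exists f; split => //; split.
  move=> eps eps0.
  have /cvgrPdist_lt /(_ _ eps0) := cf 0.
  rewrite f'0 => /nbhs_ballP [rho /= rho0 hrho]; exists rho => //.
  have main (a b : R) : a < b -> `|a| < rho -> `|b| < rho -> `|f b - f a| <= eps * `|b - a|.
    move=> ab ar br.
    have [||c cab ->] := @MVT _ f (derive1 f) a b ab.
    - by move=> c _; rewrite derive1E; apply: DeriveDef.
    - apply: continuous_subspaceT => c.
      by apply: differentiable_continuous; exact/derivable1_diffP.
    rewrite normrM ler_wpM2r//.
    have : ball 0 rho c.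
      rewrite /ball /= sub0r normrN; move: cab; rewrite in_itv /= => /andP[ac cb].
      by move: ar br; rewrite !ltr_norml => /andP[? ?] /andP[? ?]; apply/andP; split; lra.
    by move=> /hrho; rewrite sub0r normrN => /ltW.
  move=> s s' sr sr'; case: (ltgtP s s') => [h|h|->].
  - by rewrite distrC (distrC s); exact: main.
  - exact: main.
  - by rewrite !subrr normr0 mulr0.
exists (r / 2); first by rewrite divr_gt0.
move=> s t sr tr; apply: Df.
have -> : enorm (padd (pscale s (perp nu)) (pscale t nu)) = enorm (s, t).
  congr Num.sqrt; rewrite /dot /padd /pscale /perp /=.
  transitivity ((s * s + t * t) * dot nu nu); last by rewrite nu1' mulr1.
  by rewrite /dot; ring.
by apply: (le_lt_trans (enorm_le_l1 _)) => /=; lra.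
Qed.

End Chart.

(** * Moving planes *)

Section MovingPlane.
Variable R : realType.
Notation P := (R * R)%type.
Notation PM := (measurableTypeR R * measurableTypeR R)%type.
Local Notation mu := (@lebesgue_measure R \x @lebesgue_measure R)%E.
Variables (D : set P) (Omega : R).
Hypotheses (oD : open D) (D0 : D !=set0) (bD : pbounded D).
Hypothesis barD : barycenter_zero D.
Hypotheses (VD : Vstate D Omega) (Omega0 : Omega < 0).

Let mD : measurable (D : set PM) := open_measurable_plane oD.

Definition reflected_cap_sub (e : P) (l : R) := forall y, D y -> l < dot y e -> D (refl e l y).

Let area := fine (mu D).
Let area_gt0 : 0 < area := measure_open_gt0 mD bD oD D0.

(** Supplies the [K] of [stream_refl_ge], uniformly for [z] near [x]. The radius 4 covers, by
    [l1_chart], the chart points with both coordinates at most 1 in absolute value. *)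
Lemma sqdist_bound (x : P) : exists2 K : R, 0 < K &
  forall z, l1 (psub z x) <= 4 -> forall y, D y -> enorm (psub z y) ^+ 2 <= K.
Proof.
case: bD => M DM; pose N := 5 + l1 x + 2 * `|M|.
have N0 : 0 < N by rewrite /N; have := l1_ge0 x; have := normr_ge0 M; lra.
exists (N ^+ 2); first by rewrite exprn_gt0.
move=> z zx y Dy; rewrite ler_pXn2r ?nnegrE ?enorm_ge0 ?(ltW N0)//.
apply: (le_trans (enorm_le_l1 _)); rewrite -[leLHS]/(l1 (psub z y)).
have -> : psub z y = padd (padd (psub z x) x) (pscale (-1) y).
  by rewrite /padd /psub /pscale /=; congr pair; ring.
have := l1D (padd (psub z x) x) (pscale (-1) y).
have := l1D (psub z x) x.
have -> : l1 (pscale (-1) y) = l1 y by rewrite /l1 /= !mulN1r !normrN.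
have := l1_le_enorm y; have := DM y Dy; have := ler_norm M; rewrite /N; lra.
Qed.

(** The image of [y] across level l is also the image of y + 2d e across level l + d. For small d
    that point is still in the open set [D], so the limit loses nothing: the image lies in [D]
    itself and not only in its closure. *)
Lemma reflected_cap_sub_closed (e : P) l : dot e e = 1 -> (forall l', l < l' -> reflected_cap_sub e l') -> reflected_cap_sub e l.
Proof.
move=> e1 H y Dy ly; have [r r0 rD] := openP_l1 oD Dy.
pose d := Num.min (r / 5) ((dot y e - l) / 2).
have d0 : 0 < d by rewrite lt_min divr_gt0//= divr_gt0// subr_gt0.
have dr : d <= r / 5 by rewrite ge_min lexx.
have dl : d <= (dot y e - l) / 2 by rewrite ge_min lexx orbT.
pose y' := padd y (pscale (2 * d) e).
have Dy' : D y'.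
  apply: rD; have -> : psub y' y = pscale (2 * d) e.
    by rewrite /y' /psub /padd /pscale /=; congr pair; ring.
  by apply: (le_lt_trans (l1_scale _ e1)); rewrite normrM !gtr0_norm//; lra.
have ye : dot y' e = dot y e + 2 * d.
  transitivity (dot y e + 2 * d * dot e e); last by rewrite e1 mulr1.
  by rewrite /y' /dot /padd /pscale /=; ring.
have : D (refl e (l + d) y') by apply: H => //; [lra|rewrite ye; lra].
congr D; rewrite /refl ye /y' /psub /padd /pscale /=; congr pair; ring.
Qed.

(** As l > 0, [x] is farther from the origin than its mirror image, and with Omega < 0 the boundary
    equation orders the stream values accordingly. This is opposite to the strict inequality that
    [stream_refl_ge] yields. *)
Lemma stream_refl_le (e x : P) l : dot e e = 1 -> 0 < l -> l < dot x e ->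
  boundary D x -> boundary D (refl e l x) -> stream D x <= stream D (refl e l x).
Proof.
move=> e1 l0 lx bx brx; case: VD => m Hm.
have := Hm _ bx; have := Hm _ brx.
have := enorm_refl_sub l x (0, 0) e1.
have n0 z : enorm (psub z (0, 0)) = enorm z.
  by congr Num.sqrt; rewrite /dot /psub /=; ring.
rewrite !n0 (_ : dot (0, 0) e = 0); last by rewrite /dot /=; ring.
have : 0 <= (dot x e - l) * l by rewrite mulr_ge0 ?subr_ge0 ?ltW.
rewrite subr0 -mulrA; move: (_ * l) => q q0 h h1 h2.
have q1 : 0 <= q * - Omega by rewrite mulr_ge0// oppr_ge0 ltW.
move: h h1 h2; move: (enorm x ^+ 2) (enorm (refl e l x) ^+ 2) => X Y h h1 h2.
have h3 : Omega * X = Omega * Y + 4 * (q * Omega) by rewrite -[X](subrK Y) h; ring.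
by rewrite -subr_ge0; lra.
Qed.

(** If the image were not in [D], then [x] would not be either, and both would be boundary points:
    the image is a limit of reflected points of the cap. Then [stream_refl_le] contradicts
    [stream_refl_ge]. *)
Lemma interior_touching (e x : P) l : dot e e = 1 -> 0 < l -> reflected_cap_sub e l ->
  l < dot x e -> closure D x -> D (refl e l x).
Proof.
move=> e1 l0 gl lx clx; apply: contrapT => nDr.
have nDx : ~ D x by move=> Dx; apply: nDr; exact: gl.
have clr : closure D (refl e l x).
  apply/closureP_l1 => r r0.
  have [|y Dy yr] := (closureP_l1 D x).1 clx (Num.min (r / 5) (dot x e - l)).
    by rewrite lt_min divr_gt0//= subr_gt0.
  move: yr; rewrite lt_min => /andP[yr yl].
  exists (refl e l y).
    apply: gl => //; have := dot_le_l1 (psub y x) e1.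
    have -> : dot (psub y x) e = dot y e - dot x e by rewrite /dot /psub /=; ring.
    by rewrite ler_norml => /andP[? ?]; lra.
  by apply: (le_lt_trans (l1_refl _ _ _ _ e1)); rewrite subrr normr0; lra.
have := stream_refl_le e1 l0 lx (conj clx nDx) (conj clr nDr).
have [K K0 hK] := sqdist_bound x.
have := @stream_refl_ge R D e l mD bD barD e1 x K gl lx nDx nDr K0.
have xx : l1 (psub x x) <= 4 by rewrite /l1 /psub /= !subrr normr0 addr0.
move=> /(_ (hK x xx)).
have : 0 < (pi * K)^-1 * ((dot x e - l) * (l * area)).
  by rewrite mulr_gt0 ?invr_gt0 ?mulr_gt0 ?pi_gt0 ?subr_gt0.
by rewrite /area; lra.
Qed.

Lemma chart_graph_boundary (x nu : P) (f : R -> R) r s : dot nu nu = 1 ->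
  (forall s t, `|s| < r -> `|t| < r -> (D (chart x nu s t) <-> t < f s)) ->
  `|s| < r -> `|f s| < r -> boundary D (chart x nu s (f s)).
Proof.
move=> nu1 Dr sr fr; split; last by move/(Dr _ _ sr fr); rewrite ltxx.
apply/closureP_l1 => d d0.
pose h := Num.min (d / 3) ((r - `|f s|) / 2).
have h0 : 0 < h by rewrite lt_min divr_gt0//= divr_gt0// subr_gt0.
have hd : h <= d / 3 by rewrite ge_min lexx.
have hr : h <= (r - `|f s|) / 2 by rewrite ge_min lexx orbT.
exists (chart x nu s (f s - h)).
  apply/Dr => //; last lra.
  by apply: (le_lt_trans (ler_normB _ _)); rewrite (gtr0_norm h0); lra.
apply: (le_lt_trans (l1_chart _ _ _ _ _ nu1)).
rewrite subrr normr0 addrAC subrr sub0r normrN (gtr0_norm h0); lra.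
Qed.

Lemma frameE (e nu : P) : dot nu nu = 1 ->
  e = padd (pscale (dot e (perp nu)) (perp nu)) (pscale (dot e nu) nu).
Proof.
move=> nu1; have := chartE (0, 0) e nu1; have -> : psub e (0, 0) = e.
  by case: e => a b; rewrite /psub /=; congr pair; ring.
move=> {1}->; rewrite /chart /padd /=; congr pair; ring.
Qed.

Lemma shift_chart (e x nu : P) s t c : dot nu nu = 1 ->
  padd (chart x nu s t) (pscale c e) =
  chart x nu (s + c * dot e (perp nu)) (t + c * dot e nu).
Proof.
move=> nu1; rewrite {1}(frameE e nu1); move: (dot e _) (dot e _) => a b.
by rewrite /chart /padd /pscale /=; congr pair; ring.
Qed.

Lemma frame_norm (e nu : P) : dot e e = 1 -> dot nu nu = 1 ->
  dot e (perp nu) ^+ 2 + dot e nu ^+ 2 = 1.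
Proof.
move=> e1 nu1; transitivity (dot e e * dot nu nu); last by rewrite e1 nu1 mulr1.
by rewrite /dot /perp /=; ring.
Qed.

(** Write (a, b) for e in the chart frame. The reflection moves (s, t) by - tau (a, b), so the
    height drops by tau b. Near 0 the graph has Lipschitz constant at most b and |a| <= 1, so it
    drops by at most tau b, and the point stays below it. *)
Lemma transversal_cap_sub (e x nu : P) l : dot e e = 1 -> is_outward_normal D x nu ->
  dot x e = l -> 0 < dot e nu ->
  exists2 r, 0 < r & forall y l', l1 (psub y x) < r -> `|l' - l| < r ->
    D y -> l' < dot y e -> D (refl e l' y).
Proof.
move=> e1 /outward_normal_chart [nu1 [f [f0 [flip [r r0 Dr]]]]] xl b0.
have p1 : dot (perp nu) (perp nu) = 1 by rewrite dot_perp.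
have [rho rho0 hrho] := flip _ b0.
have := frame_norm e1 nu1.
set a := dot e (perp nu); set b := dot e nu in b0 hrho * => ab1.
have a1 : `|a| <= 1.
  by rewrite -(@ler_pXn2r _ 2)// ?nnegrE// real_normK ?num_real// expr1n -ab1 lerDl sqr_ge0.
have b1 : `|b| <= 1.
  by rewrite -(@ler_pXn2r _ 2)// ?nnegrE// real_normK ?num_real// expr1n -ab1 lerDr sqr_ge0.
pose m := Num.min r rho.
have m0 : 0 < m by rewrite lt_min r0.
have mr : m <= r by rewrite ge_min lexx.
have mrho : m <= rho by rewrite ge_min lexx orbT.
(* Then |s| and |t| are below m/10 and tau is at most 4m/10, so both the point and its image stay in
   the chart. *)
exists (m / 10); first by rewrite divr_gt0.
move=> y l' yx ll Dy ly.
set s := dot (psub y x) (perp nu); set t := dot (psub y x) nu.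
have yE : y = chart x nu s t := chartE x y nu1.
have sle : `|s| <= l1 (psub y x) := dot_le_l1 _ p1.
have tle : `|t| <= l1 (psub y x) := dot_le_l1 _ nu1.
pose tau := 2 * (dot y e - l').
have tau0 : 0 < tau by rewrite mulr_gt0 ?subr_gt0.
have tau_le : tau <= 4 * (m / 10).
  have := dot_le_l1 (psub y x) e1.
  have -> : dot (psub y x) e = dot y e - l by rewrite -xl /dot /psub /=; ring.
  move: ll; rewrite ltr_norml ler_norml /tau => /andP[? ?] /andP[? ?]; lra.
have rE : refl e l' y = chart x nu (s - tau * a) (t - tau * b).
  have -> : refl e l' y = padd y (pscale (- tau) e).
    by rewrite /refl /psub /padd /pscale /tau /=; congr pair; ring.
  by rewrite {1}yE shift_chart// !mulNr.
have tst : t < f s by apply/Dr; [lra|lra|rewrite -yE].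
have ta : `|tau * a| <= tau by rewrite normrM (gtr0_norm tau0) ler_piMr// ltW.
have tb : `|tau * b| <= tau by rewrite normrM (gtr0_norm tau0) ler_piMr// ltW.
have sa : `|s - tau * a| < m by apply: (le_lt_trans (ler_normB _ _)); lra.
have sb : `|t - tau * b| < m by apply: (le_lt_trans (ler_normB _ _)); lra.
rewrite rE; apply/Dr; [exact: lt_le_trans mr|exact: lt_le_trans mr|].
have : `|s| < rho by lra.
move=> /(hrho _ (s - tau * a)) /(_ (lt_le_trans sa mrho)).
rewrite opprB addrCA subrr addr0 => h.
have h2 : b * `|tau * a| <= tau * b by rewrite [leRHS]mulrC ler_pM2l.
have := le_trans (ler_norm _) h; lra.
Qed.

(** If b = e.nu were negative, x + s e would lie in [D] and in the cap for small s > 0, while its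
    mirror image x - s e would lie above the graph. The Lipschitz constant - b / 2 keeps the graph
    strictly between the heights s b and - s b. *)
Lemma normal_dot_ge0 (e x nu : P) l : dot e e = 1 -> is_outward_normal D x nu ->
  dot x e = l -> reflected_cap_sub e l -> 0 <= dot e nu.
Proof.
move=> e1 /outward_normal_chart [nu1 [f [f0 [flip [r r0 Dr]]]]] xl gl.
rewrite leNgt; apply/negP => b0.
have := frame_norm e1 nu1.
set a := dot e (perp nu); set b := dot e nu in b0 * => ab1.
have a1 : `|a| <= 1.
  by rewrite -(@ler_pXn2r _ 2)// ?nnegrE// real_normK ?num_real// expr1n -ab1 lerDl sqr_ge0.
have b1 : `|b| <= 1.
  by rewrite -(@ler_pXn2r _ 2)// ?nnegrE// real_normK ?num_real// expr1n -ab1 lerDr sqr_ge0.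
have [|rho rho0 hrho] := flip (- b / 2); first by lra.
pose m := Num.min r rho.
have m0 : 0 < m by rewrite lt_min r0.
have mr : m <= r by rewrite ge_min lexx.
have mrho : m <= rho by rewrite ge_min lexx orbT.
pose s := m / 2.
have s0 : 0 < s by rewrite divr_gt0.
have sa : `|s * a| <= s by rewrite normrM (gtr0_norm s0) ler_piMr// ltW.
have sb : `|s * b| <= s by rewrite normrM (gtr0_norm s0) ler_piMr// ltW.
have sE : s = m / 2 by [].
have z0 : `|0 : R| < rho by rewrite normr0.
have f1 : `|f (s * a)| <= - b / 2 * s.
  have := hrho (s * a) 0; rewrite f0 !subr0 => /(_ _ z0) h.
  by apply: (le_trans (h _)); [lra|rewrite ler_wpM2l//; lra].
have f2 : `|f (- (s * a))| <= - b / 2 * s.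
  have := hrho (- (s * a)) 0; rewrite f0 !subr0 normrN => /(_ _ z0) h.
  by apply: (le_trans (h _)); [lra|rewrite ler_wpM2l//; lra].
have bs : 0 < - b * s by rewrite mulr_gt0// oppr_gt0.
move: f1 f2; rewrite !ler_norml => /andP[f1 f1'] /andP[f2 f2'].
have Dy : D (chart x nu (s * a) (s * b)) by apply/Dr; lra.
have yE : chart x nu (s * a) (s * b) = padd x (pscale s e).
  by rewrite -{2}(chart0 x nu) shift_chart// !add0r.
have ye : dot (chart x nu (s * a) (s * b)) e = l + s.
  transitivity (dot x e + s * dot e e); last by rewrite e1 mulr1 xl.
  by rewrite yE /dot /padd /pscale /=; ring.
have : D (refl e l (chart x nu (s * a) (s * b))) by apply: gl => //; rewrite ye; lra.
have -> : refl e l (chart x nu (s * a) (s * b)) = chart x nu (- (s * a)) (- (s * b)).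
  have -> : refl e l (chart x nu (s * a) (s * b)) = padd x (pscale (- s) e).
    by rewrite /refl ye yE /psub /padd /pscale /=; congr pair; ring.
  by rewrite -{1}(chart0 x nu) shift_chart// !add0r !mulNr.
move/Dr; rewrite !normrN; move=> h.
by have := h ltac:(lra) ltac:(lra); lra.
Qed.

End MovingPlane.

(** * Exclusion of tangency and descent of the plane to the origin *)

Section Tangent.
Variable R : realType.
Notation P := (R * R)%type.
Notation PM := (measurableTypeR R * measurableTypeR R)%type.
Local Notation mu := (@lebesgue_measure R \x @lebesgue_measure R)%E.
Variables (D : set P) (Omega : R).
Hypotheses (oD : open D) (D0 : D !=set0) (bD : pbounded D).
Hypotheses (C1D : C1_boundary D) (barD : barycenter_zero D).
Hypotheses (VD : Vstate D Omega) (Omega0 : Omega < 0).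

Lemma sqr_enorm_chart (x nu : P) s t : dot nu nu = 1 ->
  enorm (chart x nu s t) ^+ 2 =
  dot x x + 2 * s * dot x (perp nu) + 2 * t * dot x nu + s ^+ 2 + t ^+ 2.
Proof.
move=> nu1; rewrite sqr_enorm.
transitivity (dot x x + 2 * s * dot x (perp nu) + 2 * t * dot x nu +
  (s ^+ 2 + t ^+ 2) * dot nu nu); last by rewrite nu1; ring.
by rewrite /dot /chart /padd /pscale /perp /=; ring.
Qed.

(** The arithmetic of [no_tangency]. [Sp], [Sm] are the stream values at two mirror points and [Tp],
    [Tm] those at nearby boundary points. Split Sp - Sm through the latter: the term 2 s l W of Tp -
    Tm is negative, everything else is O(eps s), and s divides out. *)
Lemma tangency_estimate (c L W X eps s l Sp Sm Tp Tm fp fm : R) :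
  0 < s -> s <= 1 -> 0 <= eps -> eps <= 1 -> 0 <= L -> 0 < l -> W < 0 ->
  c * s <= Sp - Sm -> Sp - Tp <= L * (4 * (eps * s)) -> Tm - Sm <= L * (4 * (eps * s)) ->
  `|fp| <= eps * s -> `|fm| <= eps * s ->
  Tp - Tm = 2^-1 * W * (4 * s * l + (fp - fm) * (2 * X + (fp + fm))) ->
  c <= eps * (8 * L + 2 * `|W| * (`|X| + 1)).
Proof.
move=> s0 s1 e0 e1 L0 l0 W0 cS hp hm fpe fme TT.
have es : eps * s <= 1 by rewrite -[1]mulr1 ler_pM// ltW.
have h1 : `|(fp - fm) * (2 * X + (fp + fm))| <= 2 * (eps * s) * (2 * `|X| + 2).
  rewrite normrM ler_pM//; first by apply: (le_trans (ler_normB _ _)); lra.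
  apply: (le_trans (ler_normD _ _)); rewrite normrM (@ger0_norm _ 2)//.
  by rewrite lerD2l; apply: (le_trans (ler_normD _ _)); lra.
have h2 : W * ((fp - fm) * (2 * X + (fp + fm))) <= `|W| * (2 * (eps * s) * (2 * `|X| + 2)).
  by apply: (le_trans (ler_norm _)); rewrite normrM ler_wpM2l.
have h3 : W * (s * l) <= 0 by rewrite nmulr_rle0// ltW// mulr_gt0.
rewrite -(ler_pM2r s0); apply: (le_trans cS).
have -> : eps * (8 * L + 2 * `|W| * (`|X| + 1)) * s =
  L * (4 * (eps * s)) + L * (4 * (eps * s)) + 2^-1 * (`|W| * (2 * (eps * s) * (2 * `|X| + 2))).
  by field.
have : Tp - Tm = 2 * (W * (s * l)) + 2^-1 * (W * ((fp - fm) * (2 * X + (fp + fm)))).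
  by rewrite TT; field.
move: h2 h3 hp hm; move: (_ * (_ * _)) => u; lra.
Qed.

(** When e is tangent at [x], the reflection maps the chart point (s a, t) to (- s a, t), with a = 1
    or a = -1. The lower bound on the stream difference of such a pair is linear in s, while the
    flatness of the graph and the boundary equation allow at most an arbitrarily small multiple of
    s. *)
Lemma no_tangency (e x nu : P) l : dot e e = 1 -> 0 < l -> reflected_cap_sub D e l ->
  is_outward_normal D x nu -> dot x e = l -> dot e nu <> 0.
Proof.
move=> e1 l0 gl /outward_normal_chart [nu1 [f [f0 [flip [r r0 Dr]]]]] xl enu.
have mD : measurable (D : set PM) := open_measurable_plane oD.
have area_gt0 := measure_open_gt0 mD bD oD D0.
have := frame_norm e1 nu1; rewrite enu (expr0n _ 2) addr0 /=.
set a := dot e (perp nu) => a2.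
have a1 : `|a| = 1 by apply/eqP; rewrite -sqrp_eq1// real_normK ?num_real// a2.
have xp : a * dot x (perp nu) = l.
  rewrite -xl; have -> : dot x e = dot x (padd (pscale a (perp nu)) (pscale 0 nu)).
    by rewrite {1}(frameE e nu1) enu.
  by rewrite /dot /padd /pscale /=; ring.
have [K K0 hK] := sqdist_bound bD x.
pose c := (pi * K)^-1 * (l * fine (mu D)).
have c0 : 0 < c by rewrite mulr_gt0 ?invr_gt0 ?mulr_gt0 ?pi_gt0.
have [m Hm] := VD.
pose L := `|pi^-1 * invdist_bound D|.
have L0 : 0 <= L by exact: normr_ge0.
pose N := 8 * L + 2 * `|Omega| * (`|dot x nu| + 1).
have N0 : 0 <= N by apply: addr_ge0; rewrite ?mulr_ge0 ?addr_ge0.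
(* Chosen so that eps <= 1 and eps N < c, which contradicts the conclusion c <= eps N of
   [tangency_estimate]. *)
pose eps := c / (N + 1 + c).
have d0 : 0 < N + 1 + c by rewrite addr_gt0// ltr_wpDl.
have eps0 : 0 < eps by rewrite divr_gt0.
have epsE : eps * (N + 1 + c) = c by rewrite /eps divfK// gt_eqF.
have eps1 : eps <= 1 by rewrite ler_pdivrMr// mul1r lerDr addr_ge0.
have [rho rho0 hrho] := flip _ eps0.
pose s := Num.min r (Num.min rho 1) / 2.
have s0 : 0 < s by rewrite divr_gt0// !lt_min r0 rho0 ltr01.
have sr : s < r.
  rewrite ltr_pdivrMr//; apply: (le_lt_trans (_ : _ <= r)); first by rewrite ge_min lexx.
  by rewrite ltr_pMr// ltr1n.
have srho : s < rho.
  rewrite ltr_pdivrMr//; apply: (le_lt_trans (_ : _ <= rho)).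
    by rewrite !ge_min lexx orbT.
  by rewrite ltr_pMr// ltr1n.
have s1 : s <= 1.
  rewrite ler_pdivrMr//; apply: (le_trans (_ : _ <= 1)).
    by rewrite !ge_min lexx !orbT.
  by rewrite mul1r ler1n.
have sa : `|s * a| = s by rewrite normrM a1 mulr1 gtr0_norm.
have es : eps * s <= s by rewrite ler_piMl// ltW.
have z0 : `|0 : R| < rho by rewrite normr0.
have fpe : `|f (s * a)| <= eps * s.
  by have := hrho (s * a) 0; rewrite f0 !subr0 sa; exact.
have fme : `|f (- (s * a))| <= eps * s.
  by have := hrho (- (s * a)) 0; rewrite f0 !subr0 normrN sa; exact.
set fp := f (s * a) in fpe; set fm := f (- (s * a)) in fme.
(* The boundary points over s a and - s a need not be mirror images. Raising both to the larger
   height gives an exact mirror pair outside [D], at distance O(eps s) from the boundary points. *)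
pose t := Num.max fp fm.
have te : `|t| <= eps * s by rewrite /t; case: (leP fp fm).
have tp : fp <= t by rewrite le_max lexx.
have tm : fm <= t by rewrite le_max lexx orbT.
pose pp := chart x nu (s * a) t; pose pm := chart x nu (- (s * a)) t.
have ppE : pp = padd (chart x nu 0 t) (pscale s e).
  by rewrite shift_chart// enu mulr0 addr0 add0r.
have ppe : dot pp e = l + s.
  transitivity (dot x e + t * dot e nu + s * dot e e); last by rewrite xl enu e1; ring.
  by rewrite ppE /dot /chart /padd /pscale /=; ring.
have rpp : refl e l pp = pm.
  transitivity (padd (chart x nu 0 t) (pscale (- s) e)).
    by rewrite /refl ppe ppE /psub /padd /pscale /=; congr pair; ring.
  by rewrite shift_chart// enu mulr0 addr0 add0r mulNr.
have nDpp : ~ D pp by move/Dr; rewrite sa => h; have := h sr (le_lt_trans te (le_lt_trans es sr)); rewrite -/fp ltNge tp.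
have nDpm : ~ D pm by move/Dr; rewrite normrN sa => h; have := h sr (le_lt_trans te (le_lt_trans es sr)); rewrite -/fm ltNge tm.
pose qp := chart x nu (s * a) fp; pose qm := chart x nu (- (s * a)) fm.
have bqp : boundary D qp.
  apply: (chart_graph_boundary nu1 Dr); rewrite ?sa//.
  exact: le_lt_trans fpe (le_lt_trans es sr).
have bqm : boundary D qm.
  apply: (chart_graph_boundary nu1 Dr); rewrite ?normrN ?sa//.
  exact: le_lt_trans fme (le_lt_trans es sr).
have cS : c * s <= stream D pp - stream D pm.
  have zx : l1 (psub pp x) <= 4.
    rewrite -{1}(chart0 x nu); apply: (le_trans (l1_chart _ _ _ _ _ nu1)).
    by rewrite !subr0 sa; lra.
  have lpp : l < dot pp e by rewrite ppe ltrDl.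
  rewrite -rpp in nDpm *.
  have := stream_refl_ge mD bD barD e1 gl lpp nDpp nDpm K0 (hK pp zx).
  by rewrite ppe addrAC subrr add0r /c [s * _]mulrC mulrA.
have lip z w : ~ D z -> ~ D w -> `|stream D z - stream D w| <= L * l1 (psub z w).
  move=> Dz Dw; apply: (le_trans (stream_lipschitz mD bD Dz Dw)).
  by rewrite ler_wpM2r ?l1_ge0// ler_norm.
have hp : stream D pp - stream D qp <= L * (4 * (eps * s)).
  apply: (le_trans (ler_norm _)); apply: (le_trans (lip _ _ nDpp bqp.2)).
  rewrite ler_wpM2l//; apply: (le_trans (l1_chart _ _ _ _ _ nu1)).
  by rewrite subrr normr0; have := ler_normB t fp; lra.
have hm : stream D qm - stream D pm <= L * (4 * (eps * s)).
  apply: (le_trans (ler_norm _)); apply: (le_trans (lip _ _ bqm.2 nDpm)).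
  rewrite ler_wpM2l//; apply: (le_trans (l1_chart _ _ _ _ _ nu1)).
  by rewrite subrr normr0; have := ler_normB fm t; lra.
have TT : stream D qp - stream D qm =
    2^-1 * Omega * (4 * s * l + (fp - fm) * (2 * dot x nu + (fp + fm))).
  have -> : stream D qp = m + 2^-1 * Omega * enorm qp ^+ 2 by rewrite -(Hm _ bqp); ring.
  have -> : stream D qm = m + 2^-1 * Omega * enorm qm ^+ 2 by rewrite -(Hm _ bqm); ring.
  by rewrite !sqr_enorm_chart// -xp; ring.
have := tangency_estimate s0 s1 (ltW eps0) eps1 L0 l0 Omega0 cS hp hm fpe fme TT.
rewrite -/N -{1}epsE ler_pM2l//; lra.
Qed.

(** The local step just below level l, by the position of [x]. If its image is in [D], openness
    suffices; away from the closure of [D] or strictly below the line the claim is vacuous nearby.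
    Strictly beyond the line [interior_touching] applies. On the line [x] is a boundary point, where
    e.nu is nonnegative and nonzero, so the crossing is transversal. *)
Lemma reflected_cap_sub_near (e : P) l : dot e e = 1 -> 0 < l ->
  (forall l', l < l' -> reflected_cap_sub D e l') ->
  forall x, exists2 r, 0 < r & forall y l', l1 (psub y x) < r -> `|l' - l| < r ->
    D y -> l' < dot y e -> D (refl e l' y).
Proof.
move=> e1 l0 H x; have gl := reflected_cap_sub_closed oD e1 H.
have [Drx|nDrx] := pselect (D (refl e l x)).
  have [r r0 rD] := openP_l1 oD Drx.
  exists (r / 10); first by rewrite divr_gt0.
  move=> y l' yx ll _ _; apply: rD; apply: (le_lt_trans (l1_refl _ _ _ _ e1)); lra.
have [clx|/notin_closure_l1 [r r0 rD]] := pselect (closure D x); last first.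
  by exists r => // y l' /rD.
case: (ltgtP (dot x e) l) => xl.
- exists ((l - dot x e) / 2); first by rewrite divr_gt0// subr_gt0.
  move=> y l' yx ll _ yl; exfalso.
  have := dot_le_l1 (psub y x) e1.
  have -> : dot (psub y x) e = dot y e - dot x e by rewrite /dot /psub /=; ring.
  move: ll; rewrite ltr_norml ler_norml => /andP[? ?] /andP[? ?]; lra.
- by case: nDrx; exact: (interior_touching oD D0 bD barD VD Omega0).
have rx : refl e l x = x.
  by rewrite /refl xl subrr mulr0 /psub /pscale !mul0r !subr0; case: (x).
have nDx : ~ D x by rewrite -rx.
have [nu Hnu] := C1D (conj clx nDx).
have := normal_dot_ge0 e1 Hnu xl gl.
rewrite le_eqVlt => /orP[/eqP enu|enu].
  by have := no_tangency e1 l0 gl Hnu xl; rewrite -enu.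
exact: transversal_cap_sub e1 Hnu xl enu.
Qed.

Lemma reflected_cap_sub_pos (e : P) l : dot e e = 1 -> 0 < l -> reflected_cap_sub D e l.
Proof.
move=> e1 l0; apply: contrapT => bl.
case: bD => M DM.
(* The bad levels from l upwards. Their supremum is the level where the moving plane would stop:
   every higher level is good. *)
pose B := [set l' | l <= l' /\ ~ reflected_cap_sub D e l'].
have Bl : B l by split.
have ubB : has_ubound B.
  exists (2 * M) => l' [_ nl']; rewrite leNgt; apply/negP => Ml; apply: nl' => y Dy yl.
  have := dot_le_l1 y e1; have := l1_le_enorm y; have := DM _ Dy.
  by have := ler_norm (dot y e); lra.
have supB : has_sup B by split; [exists l|].
have lsup : l <= sup B by exact: ub_le_sup.
have H l' : sup B < l' -> reflected_cap_sub D e l'.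
  move=> sl; apply: contrapT => nl'; have : B l' by split => //; lra.
  by move/(ub_le_sup ubB); lra.
have loc := reflected_cap_sub_near e1 (lt_le_trans l0 lsup) H.
pose Q l' (y : P) := D y -> l' < dot y e -> D (refl e l' y).
have cK : compact (`[- M, M]%classic `*` `[- M, M]%classic : set P).
  by apply: compact_setX; exact: segment_compact.
(* Compactness of a square containing [D] makes the local step uniform in [y]: all levels close to
   [sup B] are good, yet some bad level is as close as desired. *)
have /(_ _ (nbhs (sup B)) Q) := (compact_near_coveringP _).1 cK.
case=> [x _|d /= d0 hd].
  have [r r0 hr] := loc x.
  exists ([set y | `|y.1 - x.1| < r / 2 /\ `|y.2 - x.2| < r / 2], ball (sup B) r); last first.
    move=> [y l'] [/= [y1 y2]]; rewrite /ball /= distrC => ll.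
    by apply: hr => //; rewrite /l1 /=; lra.
  split; last exact: nbhsx_ballx.
  by apply/nbhs_boxP; exists (r / 2) => //; rewrite divr_gt0.
have [b [lb nb] db] := sup_adherent d0 supB.
have bsup : b <= sup B by exact: ub_le_sup.
apply: nb => y Dy; apply: hd => //.
  by rewrite /ball_ /= ger0_norm; lra.
have := DM _ Dy => h.
have := le_trans (enorm_fst y) h; have := le_trans (enorm_snd y) h.
by rewrite !ler_norml => /andP[? ?] /andP[? ?]; split; rewrite /= in_itv /=; apply/andP.
Qed.

(** Level 0 is reached as a limit of positive levels, for e and for - e alike. The two reflections
    at level 0 coincide, so both halves of [D] are covered. *)
Lemma reflection_symmetric (e y : P) : dot e e = 1 -> D y -> D (refl e 0 y).
Proof.
move=> e1 Dy; have g0 (e' : P) : dot e' e' = 1 -> reflected_cap_sub D e' 0.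
  by move=> e'1; apply: reflected_cap_sub_closed => // l; exact: reflected_cap_sub_pos.
case: (ltgtP 0 (dot y e)) => ye.
- exact: g0.
- pose e' := pscale (-1) e.
  have e'1 : dot e' e' = 1 by rewrite -e1 /e' /dot /pscale /=; ring.
  have ye' : dot y e' = - dot y e by rewrite /e' /dot /pscale /=; ring.
  have -> : refl e 0 y = refl e' 0 y.
    by rewrite /refl ye' /e' /psub /pscale /=; congr pair; ring.
  by apply: g0 => //; rewrite ye' oppr_gt0.
- have -> : refl e 0 y = y => //.
  by rewrite /refl -ye subrr mulr0 /psub /pscale !mul0r !subr0; case: (y).
Qed.

(** Two distinct points of equal norm are mirror images across the line through the origin
    orthogonal to x - y. *)
Lemma radial (x y : P) : enorm x = enorm y -> D x -> D y.
Proof.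
move=> xy Dx; have [<-//|/eqP nxy] := eqVneq x y.
have w0 := enorm_gt0 nxy.
pose e := pscale (enorm (psub x y))^-1 (psub x y).
have e1 : dot e e = 1.
  transitivity ((enorm (psub x y))^-1 ^+ 2 * dot (psub x y) (psub x y)).
    by rewrite /e /dot /pscale /=; ring.
  by rewrite -sqr_enorm -exprMn mulVf ?expr1n// gt_eqF.
have dxy : 2 * dot x (psub x y) = enorm (psub x y) ^+ 2.
  have : dot x x = dot y y by rewrite -!sqr_enorm xy.
  rewrite sqr_enorm /dot /psub /=; lra.
have := reflection_symmetric e1 Dx; congr D.
have -> : refl e 0 x = psub x (pscale ((enorm (psub x y))^-1 ^+ 2 * (2 * dot x (psub x y))) (psub x y)).
  by rewrite /refl /e /dot /psub /pscale /=; congr pair; ring.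
rewrite dxy -exprMn mulVf ?expr1n ?gt_eqF// /psub /pscale /=; case: (y) => a b /=.
by congr pair; ring.
Qed.

End Tangent.

(** * Radial domains *)

Section Disc.
Variable R : realType.
Notation P := (R * R)%type.
Variable D : set P.
Hypotheses (oD : open D) (D0 : D !=set0) (bD : pbounded D).
Hypothesis radD : forall x y : P, enorm x = enorm y -> D x -> D y.

Lemma enorm_axis (t : R) : 0 <= t -> enorm ((t, 0) : P) = t.
Proof. by move=> t0; rewrite /enorm /dot /= mulr0 addr0 -expr2 sqrtr_sqr ger0_norm. Qed.

Lemma radial_axis (x : P) : D x <-> D (enorm x, 0).
Proof. by split; apply: radD; rewrite enorm_axis ?enorm_ge0. Qed.

Lemma convex_radial_down : pconvex D ->
  forall x y : P, D x -> enorm y < enorm x -> D y.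
Proof.
move=> cD x y /radial_axis Dx yx; apply/radial_axis.
have x0 : 0 < enorm x := le_lt_trans (enorm_ge0 _) yx.
have Dnx : D (- enorm x, 0).
  apply: radD Dx; rewrite enorm_axis ?enorm_ge0// /enorm /dot /= mulr0 addr0 mulrNN.
  by rewrite -expr2 sqrtr_sqr ger0_norm// ltW.
(* The weight for which t |x| + (1 - t) (- |x|) = |y|, on the segment between two antipodal points
   of [D]. *)
pose t := (1 + enorm y / enorm x) / 2.
have q0 : 0 <= enorm y / enorm x by rewrite divr_ge0 ?enorm_ge0.
have q1 : enorm y / enorm x <= 1 by rewrite ler_pdivrMr// mul1r ltW.
have := cD _ _ t Dx Dnx; have -> : 0 <= t <= 1 by rewrite /t; apply/andP; split; lra.
move=> /(_ isT); congr D; rewrite /padd /pscale /t /=; congr pair; last by ring.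
by field; rewrite gt_eqF.
Qed.

(** Otherwise take the largest missing radius t0 below |x|, the outer rim of a hole. Stepping from
    (t0, 0) along nu leaves [D] by the chart, but x0.nu >= 0 makes the norm grow, and radii just
    above t0 belong to [D]. *)
Lemma normal_radial_down : C1_boundary D ->
  (forall x nu, boundary D x -> is_outward_normal D x nu -> 0 <= dot x nu) ->
  forall x y : P, D x -> enorm y < enorm x -> D y.
Proof.
move=> C1D nuD x y /radial_axis Dx yx; apply: contrapT => nDy.
pose A := [set t : R | 0 <= t <= enorm x /\ ~ D (t, 0)].
have Ay : A (enorm y).
  by split; [rewrite enorm_ge0 ltW|move=> h; apply: nDy; apply/radial_axis].
have ubA : has_ubound A by exists (enorm x) => t [/andP[]].
have supA : has_sup A by split => //; exists (enorm y).
pose t0 := sup A.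
have t0y : enorm y <= t0 by exact: ub_le_sup.
have t00 : 0 <= t0 := le_trans (enorm_ge0 _) t0y.
have t0x : t0 <= enorm x by apply: ge_sup; [exists (enorm y)|move=> t [/andP[]]].
(* The supremum is attained because [D] is open. *)
have nDt0 : ~ D (t0, 0).
  move=> Dt0; have [r r0 rD] := openP_l1 oD Dt0.
  have [t At tt0] := sup_adherent r0 supA.
  have tle : t <= t0 by exact: ub_le_sup.
  apply: At.2; apply: rD; rewrite /l1 /psub /= subrr normr0 addr0 ler0_norm ?subr_le0//.
  by rewrite -/t0 in tt0; lra.
have {}t0x : t0 < enorm x.
  by rewrite lt_neqAle t0x andbT; apply/eqP => e; apply: nDt0; rewrite e.
have above t : t0 < t -> t <= enorm x -> D (t, 0).
  move=> tt tx; apply: contrapT => nD.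
  have : A t by split=> //; apply/andP; split; lra.
  by move/(ub_le_sup ubA); rewrite leNgt tt.
have bt0 : boundary D (t0, 0).
  split => //; apply/closureP_l1 => r r0.
  pose h := Num.min (r / 2) (enorm x - t0).
  have h0 : 0 < h by rewrite lt_min divr_gt0//= subr_gt0.
  have hr : h <= r / 2 by rewrite ge_min lexx.
  have hx : h <= enorm x - t0 by rewrite ge_min lexx orbT.
  exists (t0 + h, 0); first by apply: above; lra.
  by rewrite /l1 /psub /= subrr normr0 addr0 addrAC subrr add0r gtr0_norm//; lra.
have [nu Hnu] := C1D _ bt0.
have xnu := nuD _ _ bt0 Hnu.
have [nu1 [f [f0 [_ [r r0 Dr]]]]] := outward_normal_chart Hnu.
(* By [l1_chart] a step h changes the norm by at most 2h, so the new radius does not exceed |x|. *)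
pose h := Num.min (r / 2) ((enorm x - t0) / 2).
have h0 : 0 < h by rewrite lt_min divr_gt0//= divr_gt0// subr_gt0.
have hr : h <= r / 2 by rewrite ge_min lexx.
have hx : h <= (enorm x - t0) / 2 by rewrite ge_min lexx orbT.
have [] : ~ D (chart (t0, 0) nu 0 h).
  move/Dr; rewrite normr0 gtr0_norm// f0 => k.
  by have := k r0 ltac:(lra); lra.
apply/radial_axis; apply: above.
  rewrite -(@ltr_pXn2r _ 2)// ?nnegrE ?enorm_ge0// sqr_enorm_chart//.
  have := mulr_ge0 (ltW h0) xnu; have : 0 < h ^+ 2 by rewrite exprn_gt0.
  have -> : dot ((t0, 0) : P) (t0, 0) = t0 ^+ 2 by rewrite /dot /=; ring.
  by lra.
have : enorm (chart (t0, 0) nu 0 h) - enorm ((t0, 0) : P) <=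
    l1 (psub (chart (t0, 0) nu 0 h) (t0, 0)) := sub_enorm_le _ _.
have := l1_chart (t0, 0) 0 h 0 0 nu1; rewrite chart0 enorm_axis//.
by rewrite !subr0 normr0 gtr0_norm//; lra.
Qed.

(** The radius is the supremum of the norms on [D]; openness keeps it from being attained, which
    gives the strict inequality of an open disc. *)
Lemma disc_of_radial_down :
  (forall x y : P, D x -> enorm y < enorm x -> D y) -> is_disc D.
Proof.
move=> down; pose N := [set enorm x | x in D].
have [x0 Dx0] := D0; case: bD => M DM.
have ubN : has_ubound N by exists M => _ [x Dx <-]; exact: DM.
have supN : has_sup N by split => //; exists (enorm x0), x0.
have lt_sup x : D x -> enorm x < sup N.
  move=> /radial_axis Dx; have [r r0 rD] := openP_l1 oD Dx.
  have D' : D (enorm x + r / 2, 0).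
    apply: rD; rewrite /l1 /psub /= subrr normr0 addr0 addrAC subrr add0r gtr0_norm ?divr_gt0//.
    by lra.
  have := enorm_ge0 x => ex.
  have : N (enorm x + r / 2) by exists (enorm x + r / 2, 0) => //; rewrite enorm_axis//; lra.
  by move/(ub_le_sup ubN); lra.
have n0 x : enorm (psub x (0, 0)) = enorm x.
  by congr Num.sqrt; rewrite /dot /psub /=; ring.
exists (0, 0), (sup N); split; first exact: le_lt_trans (enorm_ge0 _) (lt_sup _ Dx0).
apply/seteqP; split => x /=; rewrite n0; first exact: lt_sup.
move=> xN; have [|_ [y Dy <-] yx] := sup_adherent (_ : 0 < sup N - enorm x) supN.
  by rewrite subr_gt0.
by apply: down Dy _; move: yx; rewrite subKr.
Qed.

End Disc.

Theorem theorem1 (R : realType) (D : set (R * R)) (Omega : R) :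
  bsc_domain D -> C1_boundary D -> barycenter_zero D ->
  (pconvex D \/ Sigma (acos (Num.sqrt 5)^-1) D) ->
  Vstate D Omega -> Omega < 0 ->
  is_disc D.
Proof.
move=> [oD [D0 [bD _]]] C1D barD cD VD Omega0.
have radD := radial oD D0 bD C1D barD VD Omega0.
apply: disc_of_radial_down => //.
case: cD => [cD|[_ [_ [_ SD]]]]; first exact: convex_radial_down.
apply: normal_radial_down => // x nu bx Hnu.
by have [] := SD x nu bx Hnu.
Qed.
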